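(* Let $d\ge2$ and let $Q\in l_1(\mathbb{Z})$ be a strictly positive even function (transfer operator) with $Q(0)=1$. For $n\ge1$ let $W_n$ denote the total increment $\sum_{i=1}^n\eta_{b_i}$ along a path $(b_1,\dots,b_n)$ of length $n$ on the Cayley tree $\Gamma^d$. (a) Let $q\ge 2$ and let $\lambda_q$ be a $q$-periodic boundary law for $Q$. Then the associated gradient Gibbs measure $\nu^{\lambda_q}$ delocalizes: for every $k\in\mathbb{Z}$, $\nu^{\lambda_q}(W_n=k)\to0$ as $n\to\infty$. (b) Suppose $(\Vert Q\Vert_{\frac{d+1}{2},\mathbb{Z}},\Vert Q\Vert_{d+1,\mathbb{Z}\setminus\{0\}})\in G_d$ and let $\nu$ be the projection to the gradient space of one of the localized Gibbs measures $\mu_i$, $i\in\mathbb{Z}$, described in the context. Then $\nu$ is localized: for every $k\in\mathbb{Z}$, $\nu(W_n=k)$ has a strictly positive limit as $n\to\infty$, namely $$\lim_{n\to\infty}\nu(W_n=k)=\sum_{j\in\mathbb{Z}}\alpha(j)\alpha(j+k)>0,\qquad \alpha(j)=\mu_i(\sigma_0=j).$$ In particular, $\nu^{\lambda_q}$ in (a) is different from $\nu$ in (b).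
   Context: The Cayley tree $\Gamma^d=(V,L)$ of order $d$ is the infinite connected graph without cycles in which every vertex has exactly $d+1$ neighbours; $\vec L$ denotes the set of oriented edges. A path of length $n$ is $b_i=(x_{i-1},x_i)$, $i=1,\dots,n$, with consecutive neighbours and distinct vertices $x_0,\dots,x_n$. $0\in V$ is a fixed vertex. Norms: $\Vert x\Vert_{p,S}=\big(\sum_{j\in S}|x(j)|^p\big)^{1/p}$. Good set: $G_d:=\{(\gamma,\delta)\in(1,\infty)\times(0,\infty)\mid\exists\,\varepsilon>0:\ \delta+\gamma\varepsilon^d\le\varepsilon\ \text{ and }\ 2d\gamma\varepsilon^{d-1}+2d\delta\varepsilon^d<1\}$. Gradient configurations are $\zeta\in\mathbb{Z}^{\vec L}$ with $\zeta_{(x,y)}=-\zeta_{(y,x)}$; a height configuration $\omega\in\mathbb{Z}^V$ induces $(\nabla\omega)_{(x,y)}=\omega_y-\omega_x$. The projection of a measure on $\mathbb{Z}^V$ to the gradient space is its image under $\nabla$. $\eta$ denotes the gradient variables. Localized Gibbs measures. Let $\gamma=\Vert Q\Vert_{\frac{d+1}{2},\mathbb{Z}}$, $\delta=\Vert Q\Vert_{d+1,\mathbb{Z}\setminus\{0\}}$ with $(\gamma,\delta)\in G_d$, and take $\varepsilon>0$ as in the definition of $G_d$. On $\{x\in l_{d+1}(\mathbb{Z}\setminus\{0\}):x\ge0,\ \Vert x\Vert_{d+1,\mathbb{Z}\setminus\{0\}}\le\varepsilon\}$ the map $$T(x)(i)=\frac{Q(i)+\sum_{j\ne0}Q(i-j)|x(j)|^d}{1+\sum_{j\neq0}Q(j)|x(j)|^d}$$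 has a unique fixed point $x$. Put $\lambda(0)=1$, $\lambda(j)=x(j)^d$ for $j\ne0$, and $\lambda_i(j)=\lambda(j-i)$. Then $\mu_i$ is the tree-automorphism invariant Gibbs measure on $\mathbb{Z}^V$ (for the specification with kernels proportional to $\prod_{\{x,y\}\in L,\{x,y\}\cap\Lambda\ne\emptyset}Q(\omega_x-\omega_y)$) with marginals, for finite connected $\Lambda\subset V$ with outer boundary $\partial\Lambda$, $$\mu_i(\sigma_{\Lambda\cup\partial\Lambda}=\omega_{\Lambda\cup\partial\Lambda})=Z_\Lambda^{-1}\prod_{y\in\partial\Lambda}\lambda_i(\omega_y)\prod_{\{x,y\}\in L,\,\{x,y\}\cap\Lambda\neq\emptyset}Q(\omega_x-\omega_y).$$ Its single-site marginal is $\mu_i(\sigma_0=j)=\lambda_i(j)^{\frac{d+1}{d}}/\sum_{l\in\mathbb{Z}}\lambda_i(l)^{\frac{d+1}{d}}$. Periodic boundary laws. A $q$-periodic boundary law for $Q$ is a $q$-periodic function $\lambda_q:\mathbb{Z}\to(0,\infty)$ for which there is $c>0$ with $\lambda_q(i)=c\big(\sum_{j\in\mathbb{Z}}Q(i-j)\lambda_q(j)\big)^d$ for all $i\in\mathbb{Z}$; it is identified with a function on $\mathbb{Z}_q=\mathbb{Z}/q\mathbb{Z}$. Put $Q_q(\bar s)=\sum_{l\in\bar s}Q(l)$ for $\bar s\in\mathbb{Z}_q$. The measure $\nu^{\lambda_q}$. Let $P'_q(\bar i,\bar j)=\frac{Q_q(\bar i-\bar j)\lambda_q(\bar j)}{\sum_{\bar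 s\in\mathbb{Z}_q}Q_q(\bar i-\bar s)\lambda_q(\bar s)}$, a transition matrix on $\mathbb{Z}_q$ with reversible stationary distribution $\alpha_q(\bar i)=\lambda_q(\bar i)^{\frac{d+1}{d}}/\sum_{\bar j\in\mathbb{Z}_q}\lambda_q(\bar j)^{\frac{d+1}{d}}$. Let $P^{\lambda_q,\mathrm{f.c.}}$ be the law on $\mathbb{Z}_q^V$ of the stationary tree-indexed Markov chain $\sigma'$: for finite connected $\Lambda\ni w$, $P^{\lambda_q,\mathrm{f.c.}}(\sigma'_\Lambda)=\alpha_q(\sigma'_w)\prod P'_q(\sigma'_x,\sigma'_y)$, the product over edges $(x,y)$ in $\Lambda$ oriented away from $w$. Let $\rho^Q_q(j\mid\bar s)=\mathbf 1(j\in\bar s)\,Q(j)/Q_q(\bar s)$. Then $\nu^{\lambda_q}$ is the probability measure on gradient configurations with marginals, for finite connected $\Lambda$, $$\nu^{\lambda_q}(\eta_\Lambda=\zeta_\Lambda)=\sum_{\sigma'_\Lambda\in\mathbb{Z}_q^\Lambda}P^{\lambda_q,\mathrm{f.c.}}(\sigma'_\Lambda)\prod_{(x,y)}\rho^Q_q(\zeta_{(x,y)}\mid\sigma'_y-\sigma'_x),$$ the product over the edges inside $\Lambda$, each taken in one orientation. *)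

(* Defs.v *)
From HB Require Import structures.
From mathcomp Require Import all_boot all_order all_algebra finmap.
From mathcomp Require Import all_classical all_reals all_analysis.

Set Implicit Arguments.
Unset Strict Implicit.
Unset Printing Implicit Defensive.
Import Order.TTheory GRing.Theory Num.Theory.
Import numFieldNormedType.Exports.
Local Open Scope classical_set_scope.
Local Open Scope ring_scope.

HB.instance Definition _ := isPointed.Build int 0.

Record cayleyTree (d : nat) := CayleyTree {
  vertex :> choiceType ;
  nbr : vertex -> {fset vertex} ;
  nbr_sym : forall x y, (y \in nbr x) = (x \in nbr y) ;
  nbr_irr : forall x, x \notin nbr x ;
  nbr_card : forall x, #|` nbr x| = d.+1 ;
  tree_infinite : infinite_set [set: vertex] ;
  tree_connected : forall x y,
    exists p, path (fun u v => v \in nbr u) x p /\ last x p = y ;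
  tree_acyclic : forall c,
    ucycle (fun u v => v \in nbr u) c -> (size c <= 2)%N }.

Definition adj {d} {T : cayleyTree d} : rel T := fun x y => y \in nbr x.

(* A path of length n is given by its vertices x_0, ..., x_n. *)
Definition tree_path {d} {T : cayleyTree d} (n : nat) (p : seq T) : bool :=
  [&& sorted adj p, uniq p & size p == n.+1].

(* (x, y) is the last edge of the self-avoiding path from w to y. For each w,
   every edge of the tree has exactly one orientation with this property, so
   products over unoriented edges are written as products over these. *)
Definition away {d} {T : cayleyTree d} (w x y : T) : bool :=
  `[< exists p : seq T,
      [/\ path adj w (rcons p y), uniq (w :: rcons p y) & last w p = x] >].

Definition connected_in {d} {T : cayleyTree d} (L : {fset T}) : Prop :=
  L != fset0 /\
  forall x y, x \in L -> y \in L -> exists p : seq T,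
    [/\ path adj x p, all [in L] p & last x p = y].

Definition outer_boundary {d} {T : cayleyTree d} (L : {fset T}) : {fset T} :=
  ((\bigcup_(x <- L) nbr x) `\` L)%fset.

(* Gradient configurations, as functions on all pairs of vertices extended by
   zero outside the oriented edges. *)
Record gradient {d} (T : cayleyTree d) := Gradient {
  grad_val :> T -> T -> int ;
  grad_anti : forall x y, grad_val x y = - grad_val y x ;
  grad_off : forall x y, ~~ adj x y -> grad_val x y = 0 }.

Section GradientInstances.
Variables (d : nat) (T : cayleyTree d).

HB.instance Definition _ := gen_eqMixin (gradient T).
HB.instance Definition _ := gen_choiceMixin (gradient T).

Lemma zero_anti (x y : T) : (0 : int) = - 0.
Proof. by rewrite oppr0. Qed.

HB.instance Definition _ := isPointed.Build (gradient T)
  (@Gradient d T (fun _ _ => 0) zero_anti (fun _ _ _ => erefl)).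

Definition nabla_val (omega : T -> int) (x y : T) : int :=
  if adj x y then omega y - omega x else 0.

Lemma nabla_anti omega x y : nabla_val omega x y = - nabla_val omega y x.
Proof. by rewrite /nabla_val /adj nbr_sym; case: ifP; rewrite ?opprB ?oppr0. Qed.

Lemma nabla_off omega x y : ~~ adj x y -> nabla_val omega x y = 0.
Proof. by rewrite /nabla_val => /negbTE ->. Qed.

End GradientInstances.

Definition height_cylinders {d} (T : cayleyTree d) : set (set (T -> int)) :=
  [set A | exists v k, A = [set omega : T -> int | omega v = k]].
Arguments height_cylinders {d} T _.
Notation heights T := (g_sigma_algebraType (height_cylinders T)).

Definition gradient_cylinders {d} (T : cayleyTree d) : set (set (gradient T)) :=
  [set A | exists x y k, A = [set zeta : gradient T | zeta x y = k]].
Arguments gradient_cylinders {d} T _.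
Notation gradients T := (g_sigma_algebraType (gradient_cylinders T)).

Definition nabla {d} {T : cayleyTree d} (omega : heights T) : gradients T :=
  Gradient (nabla_anti omega) (@nabla_off d T omega).

Definition increment {d} {T : cayleyTree d} (p : seq T) (eta : gradient T)
    : int :=
  \sum_(b <- zip p (behead p)) eta b.1 b.2.

Section Weights.
Context {R : realType}.
Implicit Types (Q f lam x : int -> R) (eps : R).

(* Sum of a nonnegative family; only used on summable ones. *)
Definition sumZ (S : set int) f : R := fine (\esum_(j in S) (f j)%:E).

Definition lpnorm (p : R) (S : set int) f : \bar R :=
  ((\esum_(j in S) (`|f j| `^ p)%:E) `^ p^-1)%E.

Definition nonzero : set int := [set j | j != 0].

Definition transfer_operator Q : Prop :=
  [/\ forall j, 0 < Q j, forall j, Q (- j) = Q j, Q 0 = 1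
    & summable [set: int] (EFin \o Q)].

Definition good_eps (d : nat) (gam del eps : R) : Prop :=
  [/\ 0 < eps, del + gam * eps ^+ d <= eps
    & 2 * d%:R * gam * eps ^+ d.-1 + 2 * d%:R * del * eps ^+ d < 1].

Definition good_set (d : nat) : set (R * R) :=
  [set gd | [/\ 1 < gd.1, 0 < gd.2 & exists eps, good_eps d gd.1 gd.2 eps]].

(* If a norm were infinite, [fine] would return 0 and the pair would not be in
   [good_set d]. *)
Definition Qgamma (d : nat) Q : R :=
  fine (lpnorm (d.+1%:R / 2) [set: int] Q).
Definition Qdelta (d : nat) Q : R := fine (lpnorm d.+1%:R nonzero Q).

Definition Tmap (d : nat) Q x (i : int) : R :=
  (Q i + sumZ nonzero (fun j => Q (i - j) * `|x j| ^+ d)) /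
  (1 + sumZ nonzero (fun j => Q j * `|x j| ^+ d)).

(* x is a sequence on the nonzero integers; its value at 0 is not used. *)
Definition localized_fixpoint (d : nat) Q eps x : Prop :=
  [/\ forall j, j != 0 -> 0 <= x j,
      (lpnorm d.+1%:R nonzero x <= eps%:E)%E
    & forall i, i != 0 -> Tmap d Q x i = x i].

Definition localized_law (d : nat) x (i j : int) : R :=
  if j - i == 0 then 1 else x (j - i) ^+ d.

(* Q is even, so the edge factors do not depend on the orientation. *)
Definition gibbs_weight {d} {T : cayleyTree d} (o : T) Q lam (L : {fset T})
    (s : {ffun (L `|` outer_boundary L)%fset -> int}) : R :=
  (\prod_(y : (L `|` outer_boundary L)%fset | val y \in outer_boundary L)
     lam (s y)) *
  \prod_(b : (L `|` outer_boundary L)%fset * (L `|` outer_boundary L)%fset |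
         away o (val b.1) (val b.2) &&
         ((val b.1 \in L) || (val b.2 \in L)))
     Q (s b.1 - s b.2).

Definition partition_function {d} {T : cayleyTree d} (o : T) Q lam
    (L : {fset T}) : R :=
  fine (\esum_(s in [set: {ffun (L `|` outer_boundary L)%fset -> int}])
          (gibbs_weight o Q lam s)%:E).

(* These marginals determine mu; that mu is a Gibbs measure for the
   specification built from Q, invariant under the automorphisms of the tree,
   is a consequence when lam is a boundary law. *)
Definition gibbs_marginals {d} {T : cayleyTree d} (o : T) Q lam
    (mu : probability (heights T) R) : Prop :=
  forall (L : {fset T}) (s : {ffun (L `|` outer_boundary L)%fset -> int}),
    connected_in L ->
    mu [set sigma : heights T |
          forall y : (L `|` outer_boundary L)%fset, sigma (val y) = s y]
    = ((partition_function o Q lam L)^-1 * gibbs_weight o Q lam s)%:E.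

Definition localized_gibbs {d} {T : cayleyTree d} (o : T) Q (i : int)
    (mu : probability (heights T) R) : Prop :=
  exists eps x,
    [/\ good_eps d (Qgamma d Q) (Qdelta d Q) eps,
        localized_fixpoint d Q eps x
      & gibbs_marginals o Q (localized_law d x i) mu].

Definition periodic_boundary_law (d q : nat) Q lam : Prop :=
  [/\ forall i, 0 < lam i, forall i, lam (i + q%:Z) = lam i
    & exists2 c, 0 < c & forall i,
        lam i = c * sumZ [set: int] (fun j => Q (i - j) * lam j) ^+ d].

(* 'Z_q stands for the integers modulo q only when q >= 2. *)
Definition lam_mod (q : nat) lam (s : 'Z_q) : R := lam (nat_of_ord s)%:Z.

Definition Qmod (q : nat) Q (s : 'Z_q) : R :=
  sumZ [set l : int | l%:~R = s] Q.

Definition Pmod (q : nat) Q lam (i j : 'Z_q) : R :=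
  Qmod Q (i - j) * lam_mod lam j /
  \sum_(s : 'Z_q) Qmod Q (i - s) * lam_mod lam s.

Definition alpha_mod (d q : nat) lam (i : 'Z_q) : R :=
  lam_mod lam i `^ (d.+1%:R / d%:R) /
  \sum_(j : 'Z_q) lam_mod lam j `^ (d.+1%:R / d%:R).

(* Finite-dimensional marginals of the stationary tree-indexed Markov chain,
   started at w. *)
Definition fuzzy_chain {d} {T : cayleyTree d} (q : nat) Q lam (L : {fset T})
    (w : L) (s : {ffun L -> 'Z_q}) : R :=
  alpha_mod d lam (s w) *
  \prod_(b : L * L | away (val w) (val b.1) (val b.2))
     Pmod Q lam (s b.1) (s b.2).

Definition rho (q : nat) Q (j : int) (s : 'Z_q) : R :=
  if j%:~R == s then Q j / Qmod Q s else 0.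

Definition gradient_gibbs {d} {T : cayleyTree d} (q : nat) Q lam
    (nu : probability (gradients T) R) : Prop :=
  forall (L : {fset T}) (w : L) (zeta : gradient T),
    connected_in L ->
    nu [set eta : gradients T |
          forall x y : T, x \in L -> y \in L -> eta x y = zeta x y]
    = (\sum_(s : {ffun L -> 'Z_q})
         fuzzy_chain Q lam w s *
         \prod_(b : L * L | away (val w) (val b.1) (val b.2))
            rho Q (zeta (val b.1) (val b.2)) (s b.2 - s b.1))%:E.

End Weights.

(* Main.v *)
Require Import Defs.
From mathcomp Require Import all_boot all_order all_algebra finmap.
From mathcomp Require Import all_classical all_reals all_analysis.
From mathcomp Require Import ring lra zify.

(** Both measures turn the increments along a path into a Markov chain on the
    integers with the same kind of kernel. For a positive bounded function [lam]
    put [Qconv Q lam i], the sum over [j] of [Q (i - j) * lam j], and let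
    [gibbs_kernel Q lam i j] be [Q (i - j) * lam j / Qconv Q lam i]. All its
    entries are positive, and since [Q] is even it is reversible with respect to
    [lam i * Qconv Q lam i]. The two cases differ in the mass of this measure:
    for the localized law it is finite, for a periodic law it is bounded below
    and hence infinite.

    The dichotomy for such kernels rests on an energy argument. Let [f n] be the
    probability, as a function of the starting point, of being at [b] after [n]
    steps, and let its energy be the integral of its square against the stationary
    measure. One step lowers the energy by the mean of the variances of [f n]
    under the transitions ([energy_markov_op]). The energies are nonnegative, so
    the drops tend to zero, and because all transitions have positive probability
    the values of [f n] at any two points approach each other
    ([nstep_coalesce]). If the stationary measure is infinite, an almost constant
    function of bounded energy must be small ([nstep_null]); if it is a
    probability measure, the conserved mean forces the limit to be the stationary
    weight of [b] ([nstep_ergodic]).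

    For the localized Gibbs measure, the boundary law equation rewrites the Gibbs
    weight on a connected set and its boundary as the weight of a Markov chain
    indexed by the tree ([gibbs_weight_chain]); pruning the boundary and
    the interior of the path gives the joint law of the two end heights
    ([gibbs_two_point]). The increment equals [k] with probability the sum over
    [j] of [a j] times the probability of a move from [j] to [j + k], where [a]
    is the stationary law, and this converges by dominated convergence
    ([tannery]).

    For the gradient measure of a periodic law, the increments determine the
    hidden classes modulo [q] once the class of the starting vertex is known, and
    then the product of the class transition and the law of the increment within
    its class is one step of the kernel of [lam] ([Pmod_rho],
    [fuzzy_chain_path]). The law of the increment is therefore a finite mixture
    of null chains.

    The combinatorial input is that self-avoiding paths in a tree are determined
    by their endpoints ([geodesic_unique]): every vertex other than the root has
    exactly one parent, so products over edges are products over vertices. *)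

Set Implicit Arguments.
Unset Strict Implicit.
Unset Printing Implicit Defensive.
Import Order.TTheory GRing.Theory Num.Theory.
Import numFieldNormedType.Exports.
Local Open Scope classical_set_scope.
Local Open Scope ring_scope.

(** * Sums of nonnegative families and additivity over level sets *)

Section Sums.
Context {R : realType}.
Local Open Scope ereal_scope.

Lemma esumZl (I : choiceType) (S : set I) (c : R) (a : I -> \bar R) :
  (0 <= c)%R -> (forall i, 0 <= a i) ->
  \esum_(i in S) (c%:E * a i) = c%:E * \esum_(i in S) a i.
Proof.
move=> c0 a0; rewrite /esum -ereal_supZl//; last first.
  by apply/set0P; exists 0; exists set0; [exact: fsets_set0|rewrite fsbig_set0].
congr ereal_sup; apply/seteqP; split=> x /=.
  move=> [A AS <-]; exists (\sum_(i \in A) a i); first by exists A.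
  by rewrite ge0_mule_fsumr.
by move=> [_ [A AS <-] <-]; exists A => //; rewrite ge0_mule_fsumr.
Qed.

Lemma esum_swap (I J : choiceType) (a : I -> J -> \bar R) :
  (forall i j, 0 <= a i j) ->
  \esum_(i in [set: I]) \esum_(j in [set: J]) a i j =
  \esum_(j in [set: J]) \esum_(i in [set: I]) a i j.
Proof.
move=> a0; rewrite !esum_esum//.
rewrite (reindex_esum ([set: J] `*` [set: I]) _ (fun x => (x.2, x.1)))//.
split=> //=; first by move=> [i1 i2] [j1 j2] _ _ [-> ->].
by move=> [i j] _; exists (j, i).
Qed.

Lemma esum_ge_term (I : choiceType) (a : I -> \bar R) i0 :
  (forall i, 0 <= a i) -> a i0 <= \esum_(i in [set: I]) a i.
Proof.
move=> a0; rewrite -[leLHS](esum_set1 (t:=i0) (a:=a))//.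
rewrite [leLHS]esum_mkcond; apply: le_esum => i _.
by case: ifPn.
Qed.

Lemma esum_delta (I : choiceType) (a : I -> R) i0 :
  (0 <= a i0)%R -> \esum_(i in [set: I]) (a i * (i == i0)%:R)%:E = (a i0)%:E.
Proof.
move=> a0; rewrite -[RHS](esum_set1 (t:=i0) (a:=fun i => (a i)%:E)) ?lee_fin//.
rewrite [RHS]esum_mkcond; apply: eq_esum => i _.
by rewrite in_set1; case: eqP => _; rewrite ?mulr1 ?mulr0.
Qed.

Lemma esum_shift (a : int -> \bar R) (e f : int -> int) :
  cancel e f -> cancel f e ->
  \esum_(j in [set: int]) a j = \esum_(j in [set: int]) a (e j).
Proof.
move=> ef fe; apply: reindex_esum; split => //.
- by move=> x y _ _ /(congr1 f); rewrite !ef.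
- by move=> y _; exists (f y).
Qed.

Lemma sumZ_EFin (S : set int) (f : int -> R) :
  (forall j, S j -> 0 <= f j)%R -> \esum_(j in S) (f j)%:E < +oo ->
  \esum_(j in S) (f j)%:E = (sumZ S f)%:E.
Proof.
move=> f0 ffin; rewrite /sumZ fineK// ge0_fin_numE//.
by apply: esum_ge0 => j /f0; rewrite lee_fin.
Qed.

Lemma sumZ_ge0 (S : set int) (f : int -> R) :
  (forall j, S j -> 0 <= f j)%R -> (0 <= sumZ S f)%R.
Proof. by move=> f0; rewrite fine_ge0// esum_ge0// => j /f0. Qed.

Lemma cvg_sum0 (I : Type) (r : seq I) (f : nat -> I -> R) :
  (forall i, f n i @[n --> \oo] --> (0 : R)%R) ->
  (\sum_(i <- r) f n i)%R @[n --> \oo] --> (0 : R)%R.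
Proof.
move=> f0; elim: r => [|i r IH].
  by under eq_fun do rewrite big_nil; exact: cvg_cst.
under eq_fun do rewrite big_cons.
have := cvgD (f0 i) IH; rewrite addr0; exact.
Qed.

(** The finite head of the sum vanishes termwise, and its tail is at most the
    bound on the factors times the small tail of the weights. *)
Lemma tannery0 (w : int -> R) (g : nat -> int -> R) (M : R) :
  (forall j, 0 <= w j)%R -> \esum_(j in [set: int]) (w j)%:E < +oo ->
  (forall n j, 0 <= g n j <= M)%R ->
  (forall j, g n j @[n --> \oo] --> (0 : R)%R) ->
  \esum_(j in [set: int]) (w j * g n j)%:E @[n --> \oo] --> 0.
Proof.
move=> w0 wfin g0M g0.
have M0 : (0 <= M)%R by have /andP[] := g0M 0%N (Posz 0); exact: le_trans.
have WE := sumZ_EFin (fun j _ => w0 j) wfin; set W := sumZ _ _ in WE.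
have wg0 n j : (0 <= w j * g n j)%R by rewrite mulr_ge0//; case/andP: (g0M n j).
have wgM n (S : set int) : \esum_(j in S) (w j * g n j)%:E <=
    M%:E * \esum_(j in S) (w j)%:E.
  rewrite -esumZl//; apply: le_esum => j _.
  by rewrite lee_fin mulrC ler_wpM2r//; case/andP: (g0M n j).
have wgE n : \esum_(j in [set: int]) (w j * g n j)%:E =
    (sumZ setT (fun j => w j * g n j)%R)%:E.
  rewrite sumZ_EFin//; apply: le_lt_trans (wgM n setT) _.
  by rewrite WE -EFinM ltry.
have Asum (e : R) : (0 < e)%R -> exists A : {fset int}, forall n,
    (sumZ setT (fun j => w j * g n j)%R <= \sum_(j <- A) w j * g n j + M * e)%R.
  move=> e0.
  have : (W - e)%:E < \esum_(j in [set: int]) (w j)%:E.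
    by rewrite WE lte_fin ltrBlDr ltrDl.
  move=> /ereal_sup_gt[_ [X [finX _] <-]].
  rewrite fsbig_finite//= sumEFin lte_fin => H.
  exists (fset_set X) => n; set A := fset_set X in H *.
  have split (f : int -> R) : (forall j, 0 <= f j)%R ->
      \esum_(j in [set: int]) (f j)%:E =
      (\sum_(j <- A) f j)%:E + \esum_(j in ~` [set` A]) (f j)%:E.
    move=> f0; rewrite (esumID [set` A] setT) ?setTI; last first.
      by move=> j _; rewrite lee_fin.
    rewrite esum_fset//; last by move=> j _; rewrite lee_fin.
    by rewrite fsbig_finite//= set_fsetK sumEFin.
  rewrite -lee_fin -wgE split// EFinD leeD2l//.
  apply: le_trans (wgM n _) _; rewrite EFinM lee_wpmul2l//.
  have := split _ w0; rewrite WE.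
  case: (\esum_(j in ~` [set` A]) (w j)%:E) => //= r [Wr].
  by rewrite lee_fin; lra.
under eq_fun do rewrite wgE.
apply: (@cvg_comp _ _ _ _ EFin _ (nbhs (0:R)%R)) => //.
apply/cvgr0Pnorm_lt => e e0.
have e2 : (0 < e / 2 / (M + 1))%R by rewrite !divr_gt0// ltr_wpDl.
have [A HA] := Asum _ e2.
have /cvgr0Pnorm_lt/(_ (e / 2)%R) : 
    (\sum_(j <- A) w j * g n j)%R @[n --> \oo] --> (0 : R)%R.
  apply: cvg_sum0 => j; rewrite -(mulr0 (w j)); apply: cvgMr; exact: g0.
have -> : (0 < e / 2)%R by rewrite divr_gt0.
move=> /(_ isT) N; near=> n.
have : (`|\sum_(j <- A) w j * g n j| < e / 2)%R by near: n.
rewrite ger0_norm ?sumr_ge0// => H.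
rewrite ger0_norm ?sumZ_ge0//; apply: le_lt_trans (HA n) _.
have : (M * (e / 2 / (M + 1)) <= e / 2)%R.
  rewrite mulrCA ger_pMr ?divr_gt0// ler_pdivrMr ?ltr_wpDl// mul1r; lra.
lra.
Unshelve. all: by end_near.
Qed.
Lemma tannery (w : int -> R) (g : nat -> int -> R) (l : int -> R) (M : R) :
  (forall j, 0 <= w j)%R -> \esum_(j in [set: int]) (w j)%:E < +oo ->
  (forall n j, 0 <= g n j <= M)%R ->
  (forall j, g n j @[n --> \oo] --> l j) ->
  \esum_(j in [set: int]) (w j * g n j)%:E @[n --> \oo] -->
  \esum_(j in [set: int]) (w j * l j)%:E.
Proof.
move=> w0 wfin g0M gl.
have l0M j : (0 <= l j <= M)%R.
  have cg : cvgn (g ^~ j) by apply/cvg_ex; exists (l j); exact: gl.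
  rewrite -(cvg_lim (@Rhausdorff R) (gl j)) limr_ge ?limr_le//;
    by apply: nearW => n; case/andP: (g0M n j).
have h0M n j : (0 <= `|g n j - l j| <= M)%R.
  rewrite normr_ge0 ler_norml.
  by have /andP[? ?] := g0M n j; have /andP[? ?] := l0M j; lra.
have fin (f : int -> R) : (forall j, 0 <= f j <= M)%R ->
    \esum_(j in [set: int]) (w j * f j)%:E =
    (sumZ setT (fun j => w j * f j)%R)%:E.
  move=> f0M; apply: sumZ_EFin => [j _|].
    by apply: mulr_ge0 => //; case/andP: (f0M j).
  apply: le_lt_trans (_ : \esum_(j in [set: int]) (M%:E * (w j)%:E) < _).
    apply: le_esum => j _; rewrite -EFinM lee_fin mulrC ler_wpM2r//.
    by case/andP: (f0M j).
  have M0 : (0 <= M)%R by have /andP[] := g0M 0%N (Posz 0); exact: le_trans.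
  by rewrite esumZl// (sumZ_EFin (fun j _ => w0 j) wfin) -EFinM ltry.
have T : (sumZ setT (fun j => w j * `|g n j - l j|)%R) @[n --> \oo] --> (0 : R)%R.
  have : \esum_(j in [set: int]) (w j * `|g n j - l j|)%:E @[n --> \oo] --> 0.
    apply: (tannery0 (M:=M)) => // j.
    have := cvg_norm (cvgB (gl j) (cvg_cst (l j))).
    by rewrite subrr normr0; exact.
  by under eq_fun do rewrite fin//; move/fine_cvg.
have comp (f1 f2 f3 : int -> R) : (forall j, 0 <= f1 j <= M)%R ->
    (forall j, 0 <= f2 j <= M)%R -> (forall j, 0 <= f3 j <= M)%R ->
    (forall j, f1 j <= f2 j + f3 j)%R ->
    (sumZ setT (fun j => w j * f1 j) <=
     sumZ setT (fun j => w j * f2 j) + sumZ setT (fun j => w j * f3 j))%R.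
  move=> b1 b2 b3 le; rewrite -lee_fin EFinD -!fin// -esumD.
  - by apply: le_esum => j _; rewrite -EFinD lee_fin -mulrDr ler_wpM2l.
  - by move=> j _; rewrite lee_fin mulr_ge0//; case/andP: (b2 j).
  - by move=> j _; rewrite lee_fin mulr_ge0//; case/andP: (b3 j).
rewrite fin//; under eq_fun do rewrite fin//.
apply: (@cvg_comp _ _ _ _ EFin _ (nbhs (sumZ setT (fun j => w j * l j)%R))) => //.
apply/cvgrPdist_le => r r0; move/cvgr0Pnorm_le/(_ r r0) : T => T.
near=> n.
have : (`|sumZ setT (fun j => w j * `|g n j - l j|)| <= r)%R by near: n.
move=> /(le_trans (ler_norm _)) S.
have le1 j : (g n j <= l j + `|g n j - l j|)%R by rewrite -lerBlDl ler_norm.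
have le2 j : (l j <= g n j + `|g n j - l j|)%R.
  by rewrite -lerBlDl distrC ler_norm.
have := comp _ _ _ (g0M n) l0M (h0M n) le1.
have := comp _ _ _ l0M (g0M n) (h0M n) le2.
by move=> c1 c2; rewrite ler_norml; apply/andP; split; lra.
Unshelve. all: by end_near.
Qed.

(** Countable additivity over the values of [X], transported from the naturals by
    the enumeration [choice.pickle] of the integers. *)
Lemma measure_level d (W : measurableType d) (mu : {measure set W -> \bar R})
    (A : set W) (X : W -> int) :
  measurable A -> (forall j, measurable [set w | X w = j]) ->
  mu A = \esum_(j in [set: int]) mu (A `&` [set w | X w = j]).
Proof.
move=> mA mX; pose F n := A `&` [set w | choice.pickle (X w) = n].
have F0 n : ~ ((@choice.pickle int) @` [set: int]) n -> F n = set0.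
  by move=> H; apply/seteqP; split=> // w [_ /= Xn]; apply: H; exists (X w).
have mF n : measurable (F n).
  have [[j _ jn]|/F0->//] := pselect (((@choice.pickle int) @` [set: int]) n).
  suff -> : F n = A `&` [set w | X w = j] by exact: measurableI.
  rewrite /F -jn; congr (_ `&` _); apply/seteqP; split=> w /=.
    exact: (pcan_inj choice.pickleK).
  by move=> ->.
have AE : A = \bigcup_n F n.
  apply/seteqP; split=> w; last by case=> n _ [].
  by move=> Aw; exists (choice.pickle (X w)).
rewrite {1}AE measure_semi_bigcup//; last first.
- exact: bigcupT_measurable.
- by move=> m n _ _ [w [[_ /= <-] [_ /= <-]]].
rewrite nneseries_esumT//.
transitivity (\esum_(n in (@choice.pickle int) @` [set: int]) mu (F n)).
  rewrite [RHS]esum_mkcond; apply: eq_esum => n _.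
  by case: ifPn => //; rewrite notin_setE => /F0 ->.
rewrite esum_image; last by move=> x y _ _; exact: (pcan_inj choice.pickleK).
apply: eq_esum => j _; congr (mu _); apply/seteqP.
by split=> w [Aw /= jw]; split=> //=; [exact: (pcan_inj choice.pickleK)|rewrite jw].
Qed.

Lemma measurable_levelD d (W : measurableType d) (X Y : W -> int) :
  (forall j, measurable [set w | X w = j]) ->
  (forall j, measurable [set w | Y w = j]) ->
  forall j, measurable [set w | (X w + Y w)%R = j].
Proof.
move=> mX mY j.
have -> : [set w | (X w + Y w)%R = j] =
    \bigcup_i ([set w | X w = i] `&` [set w | Y w = (j - i)%R]).
  apply/seteqP; split=> w /=; last by move=> [i _ [-> ->]]; rewrite addrC subrK.
  by move=> <-; exists (X w) => //; split=> //=; rewrite addrC addKr.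
apply: countable_bigcupT_measurable => // i; exact: measurableI.
Qed.

Lemma measurable_level_sum d (W : measurableType d) (I : Type) (r : seq I)
    (X : I -> W -> int) :
  (forall i j, measurable [set w | X i w = j]) ->
  forall j, measurable [set w | (\sum_(i <- r) X i w)%R = j].
Proof.
move=> mX; elim: r => [|i r IH] j.
  have -> : [set w | (\sum_(i <- [::]) X i w)%R = j] = [set _ | 0%R = j].
    by apply/seteqP; split=> w /=; rewrite big_nil.
  have [<-|j0] := pselect (0%R = j); first by rewrite (_ : mkset _ = setT)// eqEsubset.
  by rewrite (_ : mkset _ = set0)// eqEsubset; split.
have -> : [set w | (\sum_(i <- i :: r) X i w)%R = j] =
    [set w | (X i w + \sum_(i <- r) X i w)%R = j].
  by apply/seteqP; split=> w /=; rewrite big_cons.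
exact: measurable_levelD.
Qed.
End Sums.

(** * Markov chains on the integers with positive transitions *)

Section Markov.
Context {R : realType}.
Implicit Types (K : int -> int -> R) (pi f g : int -> R).

Definition stochastic K : Prop :=
  (forall i j, 0 < K i j) /\ forall i, \esum_(j in [set: int]) (K i j)%:E = 1%E.

Definition stationary K pi : Prop :=
  (forall i, 0 < pi i) /\
  forall j, \esum_(i in [set: int]) (pi i * K i j)%:E = (pi j)%:E.

Definition markov_op K f (i : int) : R := sumZ setT (fun j => K i j * f j).

(** Iterating the operator on the indicator of [b] and evaluating at [a] gives the
    probability of going from [a] to [b] in [n] steps. *)
Definition nstep K (n : nat) (a b : int) : R :=
  iter n (markov_op K) (fun i => (i == b)%:R) a.

Definition unit_valued f : Prop := forall j, 0 <= f j <= 1.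

Definition energy pi f : \bar R := \esum_(a in [set: int]) (pi a * f a ^+ 2)%:E.

Lemma unit_valued_sqr f : unit_valued f -> unit_valued (fun j => f j ^+ 2).
Proof. by move=> f1 j; rewrite sqr_ge0 exprn_ile1//; case/andP: (f1 j). Qed.

Lemma markov_opE K f i : stochastic K -> unit_valued f ->
  \esum_(j in [set: int]) (K i j * f j)%:E = (markov_op K f i)%:E.
Proof.
move=> [K0 K1] f1; apply: sumZ_EFin => [j _|].
  by apply: mulr_ge0; [exact/ltW|case/andP: (f1 j)].
apply: (@le_lt_trans _ _ 1%E); last by rewrite ltry.
rewrite -(K1 i); apply: le_esum => j _; rewrite lee_fin ger_pMr//.
by case/andP: (f1 j).
Qed.

Lemma markov_op_unit K f :
  stochastic K -> unit_valued f -> unit_valued (markov_op K f).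
Proof.
move=> [K0 K1] f1 i; rewrite -!lee_fin -markov_opE//; apply/andP; split.
  apply: esum_ge0 => j _; rewrite lee_fin.
  by apply: mulr_ge0; [exact/ltW|case/andP: (f1 j)].
rewrite -(K1 i); apply: le_esum => j _; rewrite lee_fin ger_pMr//.
by case/andP: (f1 j).
Qed.

Lemma nstep_unit K n b : stochastic K -> unit_valued (nstep K n ^~ b).
Proof.
move=> KS; rewrite /nstep; elim: n => [j|n IH] /=; last exact: markov_op_unit.
by case: eqP => _; rewrite ?(mulr1n, mulr0n) ?lexx ?ler01.
Qed.

(** The second moment of [f] under [K a] exceeds the square of its mean by the
    variance, which is at least the contribution of any single point. *)
Lemma markov_op_sqr_ge K f a c : stochastic K -> unit_valued f ->
  markov_op K f a ^+ 2 + K a c * (f c - markov_op K f a) ^+ 2 <=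
  markov_op K (fun j => f j ^+ 2) a.
Proof.
move=> KS f1; have [K0 K1] := KS; set m := markov_op K f a.
have f0 j : 0 <= f j by case/andP: (f1 j).
have m0 : 0 <= m by case/andP: (markov_op_unit KS f1 a).
pose V := \esum_(j in [set: int]) (K a j * (f j - m) ^+ 2)%:E.
have VE : ((markov_op K (fun j => f j ^+ 2) a)%:E + (m ^+ 2)%:E =
    (2 * m ^+ 2)%:E + V)%E.
  have -> : (m ^+ 2)%:E = \esum_(j in [set: int]) (m ^+ 2 * K a j)%:E.
    rewrite (esumZl _ (sqr_ge0 m) (a:=fun j => (K a j)%:E)) ?K1 ?mule1// => j.
    by rewrite lee_fin ltW.
  have -> : (2 * m ^+ 2)%:E = \esum_(j in [set: int]) (2 * m * (K a j * f j))%:E.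
    rewrite (esumZl _ (c:=2 * m) (a:=fun j => (K a j * f j)%:E)) ?mulr_ge0//.
      by rewrite markov_opE// -EFinM -mulrA -expr2.
    by move=> j; rewrite lee_fin mulr_ge0// ltW.
  rewrite -markov_opE//; last exact: unit_valued_sqr.
  have Kp j : 0 <= K a j by exact: ltW.
  rewrite /V -!esumD.
  - by apply: eq_esum => j _; rewrite -!EFinD; congr EFin; ring.
  - by move=> j _; rewrite lee_fin mulr_ge0 ?sqr_ge0// ?mulr_ge0.
  - by move=> j _; rewrite lee_fin mulr_ge0 ?sqr_ge0// ?mulr_ge0.
  - by move=> j _; rewrite lee_fin mulr_ge0 ?sqr_ge0// ?mulr_ge0.
  - by move=> j _; rewrite lee_fin mulr_ge0 ?sqr_ge0// ?mulr_ge0.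
have : ((K a c * (f c - m) ^+ 2)%:E <= V)%E.
  apply: (esum_ge_term (a:=fun j => (K a j * (f j - m) ^+ 2)%:E)) => j.
  by rewrite lee_fin mulr_ge0 ?sqr_ge0// ltW.
by case: V VE => //= v [H]; rewrite lee_fin; lra.
Qed.

Lemma stationary_markov_op K pi f :
  stochastic K -> stationary K pi -> unit_valued f ->
  \esum_(a in [set: int]) (pi a * markov_op K f a)%:E =
  \esum_(a in [set: int]) (pi a * f a)%:E.
Proof.
move=> KS [pi0 piK] f1; have [K0 K1] := KS.
have f0 j : 0 <= f j by case/andP: (f1 j).
transitivity (\esum_(a in [set: int]) \esum_(c in [set: int])
    (pi a * K a c * f c)%:E).
  apply: eq_esum => a _; rewrite EFinM -markov_opE// -esumZl ?ltW//.
    by apply: eq_esum => c _; rewrite -EFinM mulrA.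
  by move=> c; rewrite lee_fin mulr_ge0// ltW.
rewrite esum_swap => [|a c]; last by rewrite lee_fin !mulr_ge0// ltW.
apply: eq_esum => c _; rewrite mulrC EFinM -piK -esumZl//.
  by apply: eq_esum => a _; rewrite -EFinM mulrC.
by move=> a; rewrite lee_fin mulr_ge0// ltW.
Qed.

Lemma drop_ge0 (x y z : R) : 0 < x -> 0 < y -> 0 <= x * (y * z ^+ 2).
Proof. by move=> x0 y0; rewrite pmulr_rge0// pmulr_rge0// sqr_ge0. Qed.

(** By stationarity [energy pi f] is the [pi]-mean of the second moments of [f]
    under the transitions, and each second moment exceeds the squared mean by a
    variance. *)
Lemma energy_markov_op K pi f a c :
  stochastic K -> stationary K pi -> unit_valued f ->
  (energy pi (markov_op K f) +
     (pi a * (K a c * (f c - markov_op K f a) ^+ 2))%:E <= energy pi f)%E.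
Proof.
move=> KS piS f1; have [K0 K1] := KS; have [pi0 _] := piS.
rewrite {2}/energy -(stationary_markov_op KS piS (unit_valued_sqr f1)).
have D0 x : 0 <= pi x * (K x c * (f c - markov_op K f x) ^+ 2).
  exact: drop_ge0.
rewrite -(esum_delta (a:=fun x => pi x * (K x c * (f c - markov_op K f x) ^+ 2)))//.
rewrite -esumD; last 2 first.
- by move=> x _; rewrite lee_fin mulr_ge0 ?sqr_ge0// ltW.
- by move=> x _; rewrite lee_fin mulr_ge0.
apply: le_esum => x _; rewrite -EFinD lee_fin.
apply: (@le_trans _ _ (pi x * (markov_op K f x ^+ 2 +
    K x c * (f c - markov_op K f x) ^+ 2))).
  by rewrite mulrDr lerD2l; case: eqP => _; rewrite ?mulr1// mulr0.
by rewrite ler_pM2l// markov_op_sqr_ge.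
Qed.

Lemma energy_nstep K pi n b : stochastic K -> stationary K pi ->
  (energy pi (nstep K n ^~ b) <= (pi b)%:E)%E.
Proof.
move=> KS piS; have [pi0 _] := piS; elim: n => [|n IH].
  rewrite /energy -(esum_delta (a:=pi) (i0:=b)); last exact: ltW.
  apply: le_esum => a _.
  by rewrite /nstep/= lee_fin; case: eqP => _; rewrite ?expr1n// expr0n.
apply: le_trans IH; have := energy_markov_op b b KS piS (nstep_unit n b KS).
apply: le_trans; rewrite leeDl// lee_fin drop_ge0//.
by case: KS => + _; exact.
Qed.

(** The energies of the successive iterates decrease to a limit, so the drops
    vanish; the drop at step [n] controls [nstep K n c b - nstep K n.+1 a b] for
    all [a] and [c], since every transition has positive probability. *)
Lemma nstep_coalesce K pi a c b : stochastic K -> stationary K pi ->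
  (nstep K n c b - nstep K n a b) @[n --> \oo] --> (0 : R).
Proof.
move=> KS piS; have [K0 K1] := KS; have [pi0 _] := piS.
pose e n := fine (energy pi (nstep K n ^~ b)).
have eE n : energy pi (nstep K n ^~ b) = (e n)%:E.
  rewrite /e fineK// ge0_fin_numE; 
    first exact: le_lt_trans (energy_nstep n b KS piS) (ltry _).
  by apply: esum_ge0 => x _; rewrite lee_fin mulr_ge0 ?sqr_ge0// ltW.
have e0 n : 0 <= e n.
  rewrite -lee_fin -eE; apply: esum_ge0 => x _.
  by rewrite lee_fin mulr_ge0 ?sqr_ge0// ltW.
have drop n x y :
    e n.+1 + pi x * (K x y * (nstep K n y b - nstep K n.+1 x b) ^+ 2) <= e n.
  rewrite -lee_fin EFinD -!eE.
  exact: (energy_markov_op x y KS piS (nstep_unit n b KS)).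
have dec : {homo e : m n / (m <= n)%N >-> n <= m}.
  apply/nonincreasing_seqP => n; apply: le_trans (drop n b b).
  by rewrite lerDl drop_ge0.
have ecvg : cvgn e.
  by apply: nonincreasing_is_cvgn => //; exists 0 => _ [n _ <-].
have d0 : (e n - e n.+1) @[n --> \oo] --> (0 : R).
  rewrite -(subrr (limn e)); apply: cvgB => //.
  by rewrite (cvg_shiftS e).
have step x y : (nstep K n y b - nstep K n.+1 x b) @[n --> \oo] --> (0 : R).
  apply/cvgr0Pnorm_lt => r r0.
  have k0 : 0 < pi x * K x y by rewrite mulr_gt0.
  have r2 : 0 < pi x * K x y * r ^+ 2 by rewrite mulr_gt0 ?exprn_gt0.
  move/cvgr0Pnorm_lt/(_ _ r2): d0 => d0; near=> n.
  have : `|e n - e n.+1| < pi x * K x y * r ^+ 2 by near: n.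
  rewrite ger0_norm ?subr_ge0 ?dec// => H.
  have : pi x * K x y * (nstep K n y b - nstep K n.+1 x b) ^+ 2 < pi x * K x y * r ^+ 2.
    by apply: le_lt_trans H; have := drop n x y; lra.
  rewrite ltr_pM2l// => {}H.
  by rewrite -(ltr_pXn2r (n:=2))// ?nnegrE ?normr_ge0// ?(ltW r0)// real_normK// num_real.
have -> : (fun n => nstep K n c b - nstep K n a b) =
    (fun n => (nstep K n c b - nstep K n.+1 b b) - (nstep K n a b - nstep K n.+1 b b)).
  by apply/funext => n; ring.
have := cvgB (step b c) (step b a); rewrite subrr; exact.
Unshelve. all: by end_near.
Qed.

(** With infinite stationary mass, finitely many points have arbitrarily large
    mass; the iterate is nearly constant on them, and its energy is bounded. *)
Lemma nstep_null K pi (m : R) a b : stochastic K -> stationary K pi ->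
  0 < m -> (forall i, m <= pi i) -> nstep K n a b @[n --> \oo] --> (0 : R).
Proof.
move=> KS piS m0 mpi; have [pi0 _] := piS.
apply/cvgr0Pnorm_lt => r r0.
have r2 : 0 < m * (r / 2) ^+ 2 by rewrite mulr_gt0 ?exprn_gt0 ?divr_gt0.
(* [N] points of mass at least [m], each with value at least [r / 2], would carry
   more energy than the initial indicator *)
have [N NP] : exists N, pi b < N%:R * (m * (r / 2) ^+ 2).
  exists (Num.truncn (pi b / (m * (r / 2) ^+ 2))).+1.
  by rewrite -ltr_pdivrMr// truncnS_gt.
have : \forall n \near \oo, forall i, (i < N)%N ->
    `|nstep K n a b - nstep K n (Posz i) b| < r / 2.
  elim: N {NP} => [|N IH]; first by near=> n.
  have /cvgr0Pnorm_lt/(_ (r / 2)) := nstep_coalesce (Posz N) a b KS piS.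
  rewrite divr_gt0// => /(_ isT) HN; near=> n => i.
  rewrite ltnS leq_eqVlt => /orP[/eqP->|].
    by near: n.
  by move: i; near: n.
move=> H; near=> n.
have Hn i : (i < N)%N -> `|nstep K n a b - nstep K n (Posz i) b| < r / 2.
  by move: i; near: n.
rewrite ger0_norm; last by case/andP: (nstep_unit n b KS a).
rewrite ltNge; apply/negP => ra.
have lo i : (i < N)%N -> r / 2 <= nstep K n (Posz i) b.
  by move=> /Hn; rewrite ltr_norml => /andP[_ H2]; lra.
have : ((N%:R * (m * (r / 2) ^+ 2))%:E <= energy pi (nstep K n ^~ b))%E.
  apply: esum_ge; exists [set` [fset Posz i | i in iota 0 N]%fset].
    by split=> //; exact: finite_fset.
  rewrite fsbig_finite//= set_fsetK big_imfset/=; last by move=> i j _ _ [].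
  rewrite undup_id ?iota_uniq// sumEFin lee_fin mulr_natl.
  rewrite -[N in _ *+ N]subn0 -sumr_const_nat.
  rewrite /index_iota subn0 !big_seq; apply: ler_sum => i; rewrite mem_iota => iN.
  apply: ler_pM; rewrite ?sqr_ge0//; first exact: ltW.
  have : r / 2 <= nstep K n (Posz i) b by exact: lo.
  move=> rn; rewrite ler_sqr// nnegrE; first by rewrite divr_ge0// ltW.
  by case/andP: (nstep_unit n b KS (Posz i)).
move=> /le_trans/(_ (energy_nstep n b KS piS)); rewrite lee_fin.
by rewrite leNgt NP.
Unshelve. all: by end_near.
Qed.

Lemma nstep_stationary K pi n b : stochastic K -> stationary K pi ->
  \esum_(i in [set: int]) (pi i * nstep K n i b)%:E = (pi b)%:E.
Proof.
move=> KS piS; have [pi0 _] := piS.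
elim: n => [|n IH]; first by rewrite -(esum_delta (a:=pi) (i0:=b))// ltW.
by rewrite -IH -(stationary_markov_op KS piS (nstep_unit n b KS)).
Qed.

(** The mean of the iterates under [pi] stays equal to [pi b], and the iterates
    become constant. *)
Lemma nstep_ergodic K pi a b : stochastic K -> stationary K pi ->
  \esum_(i in [set: int]) (pi i)%:E = 1%E ->
  nstep K n a b @[n --> \oo] --> pi b.
Proof.
move=> KS piS pi1; have [pi0 _] := piS.
have piW i : 0 <= pi i by exact: ltW.
have f01 n i : 0 <= nstep K n i b <= 1 := nstep_unit n b KS i.
(* the differences are shifted by 1 to make all the sums nonnegative *)
have lim i : (nstep K n i b - nstep K n a b + 1) @[n --> \oo] --> (1 : R).
  have := cvgD (nstep_coalesce a i b KS piS) (cvg_cst (1 : R)).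
  by rewrite add0r; exact.
have mean n : \esum_(i in [set: int])
    (pi i * (nstep K n i b - nstep K n a b + 1))%:E =
    (pi b + 1 - nstep K n a b)%:E.
  have c0 : 0 <= 1 - nstep K n a b by have /andP[_] := f01 n a; rewrite subr_ge0.
  transitivity (\esum_(i in [set: int]) ((pi i * nstep K n i b)%:E +
      (1 - nstep K n a b)%:E * (pi i)%:E))%E.
    by apply: eq_esum => i _; rewrite -EFinM -EFinD; congr EFin; ring.
  rewrite esumD.
  - rewrite (nstep_stationary _ _ KS piS) esumZl// pi1 mule1 -EFinD.
    by rewrite addrA.
  - by move=> i _; rewrite lee_fin mulr_ge0//; case/andP: (f01 n i).
  - by move=> i _; rewrite -EFinM lee_fin mulr_ge0.
have H : (pi b + 1 - nstep K n a b)%:E @[n --> \oo] --> 1%:E.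
  have -> : (fun n => (pi b + 1 - nstep K n a b)%:E) = (fun n =>
      \esum_(i in [set: int]) (pi i * (nstep K n i b - nstep K n a b + 1))%:E).
    by apply/funext => n; rewrite mean.
  have -> : 1%:E = \esum_(i in [set: int]) (pi i * 1)%:E.
    by under eq_esum do rewrite mulr1.
  apply: (tannery (M:=2)) => // [|n i]; first by rewrite pi1 ltry.
  by have /andP[? ?] := f01 n i; have /andP[? ?] := f01 n a; lra.
move/fine_cvg in H.
have -> : (fun n => nstep K n a b) =
    (fun n => pi b + 1 - fine (pi b + 1 - nstep K n a b)%:E).
  by apply/funext => n /=; ring.
by have := cvgB (cvg_cst (pi b + 1)) H; rewrite addrK; exact.
Qed.
End Markov.

(** * The kernel of a boundary law and its path marginals *)

Section GibbsKernel.
Context {R : realType}.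
Implicit Types (Q lam : int -> R).

Definition Qconv Q lam (i : int) : R := sumZ setT (fun j => Q (i - j) * lam j).

Definition gibbs_kernel Q lam (i j : int) : R :=
  Q (i - j) * lam j / Qconv Q lam i.

Lemma stationaryZ (K : int -> int -> R) pi (C : R) :
  stochastic K -> stationary K pi -> 0 < C -> stationary K (fun i => C * pi i).
Proof.
move=> [K0 _] [pi0 piK] C0; split=> [i|j]; first by rewrite mulr_gt0.
rewrite EFinM -piK -esumZl ?ltW//; last by move=> i; rewrite lee_fin mulr_ge0// ltW.
by apply: eq_esum => i _; rewrite -EFinM mulrA.
Qed.

Section Kernel.
Variables (Q lam : int -> R) (M : R).
Hypothesis hQ : transfer_operator Q.
Hypothesis lam0 : forall i, 0 < lam i.
Hypothesis lamM : forall i, lam i <= M.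

Let Q0 i : 0 < Q i. Proof. by case: hQ. Qed.
Let Qsym i : Q (- i) = Q i. Proof. by case: hQ. Qed.

Let Qlam_ge0 i j : 0 <= Q (i - j) * lam j.
Proof. by rewrite mulr_ge0// ltW. Qed.

Lemma QconvE i :
  \esum_(j in [set: int]) (Q (i - j) * lam j)%:E = (Qconv Q lam i)%:E.
Proof.
apply: sumZ_EFin => // ; have [_ _ _ sQ] := hQ.
have M0 : 0 <= M by apply: le_trans (lamM 0); exact: ltW.
apply: (@le_lt_trans _ _ (M%:E * \esum_(j in [set: int]) (Q (i - j))%:E)%E).
  rewrite -esumZl//; last by move=> j; rewrite lee_fin ltW.
  by apply: le_esum => j _; rewrite lee_fin mulrC ler_wpM2r// ltW.
have -> : \esum_(j in [set: int]) (Q (i - j))%:E = \esum_(j in [set: int]) (Q j)%:E.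
  rewrite [RHS](esum_shift (fun j => (Q j)%:E) (e:=fun j => i - j) (f:=fun j => i - j))//.
    by move=> j; rewrite opprB addrC subrK.
  by move=> j; rewrite opprB addrC subrK.
have : \esum_(j in [set: int]) (Q j)%:E \is a fin_num.
  have := summableE setT (EFin \o Q); rewrite sQ => /esym.
  congr (_ \is a fin_num); apply: eq_esum => j _ /=.
  by rewrite ger0_norm// ltW.
by move=> /fineK <-; rewrite -EFinM ltry.
Qed.

Lemma Qconv_ge i : lam i <= Qconv Q lam i.
Proof.
rewrite -lee_fin -QconvE; have [_ _ Q1 _] := hQ.
have := esum_ge_term (a:=fun j => (Q (i - j) * lam j)%:E) i.
by rewrite subrr Q1 mul1r; apply => j; rewrite lee_fin.
Qed.

Lemma Qconv_gt0 i : 0 < Qconv Q lam i.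
Proof. exact: lt_le_trans (Qconv_ge i). Qed.

Lemma gibbs_kernel_stochastic : stochastic (gibbs_kernel Q lam).
Proof.
split=> [i j|i]; first by rewrite divr_gt0 ?mulr_gt0 ?Qconv_gt0.
rewrite /gibbs_kernel; under eq_esum do rewrite mulrC EFinM.
rewrite esumZl ?invr_ge0 ?(ltW (Qconv_gt0 i))//.
  by rewrite QconvE -EFinM mulVf// gt_eqF// Qconv_gt0.
by move=> j; rewrite lee_fin.
Qed.

(** Detailed balance: [lam i * Qconv Q lam i * gibbs_kernel Q lam i j] is
    [lam i * Q (i - j) * lam j], which is symmetric because [Q] is even. *)
Lemma gibbs_kernel_stationary :
  stationary (gibbs_kernel Q lam) (fun i => lam i * Qconv Q lam i).
Proof.
split=> [i|j]; first by rewrite mulr_gt0 ?Qconv_gt0.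
rewrite EFinM -QconvE -esumZl ?ltW//; last by move=> i; rewrite lee_fin.
apply: eq_esum => i _; rewrite -EFinM -(Qsym (j - i)) opprB /gibbs_kernel.
by congr EFin; field; rewrite gt_eqF// Qconv_gt0.
Qed.
End Kernel.
End GibbsKernel.

Section PathElimination.
Context {R : realType} d (W : measurableType d).

(** The law of a mixture of Markov chains determines its two-point marginals:
    sum out the last interior state, then the one before it, and so on. *)
Lemma path_elimination (mu : {measure set W -> \bar R}) (I : finType)
    (X : nat -> W -> int) (w : I -> int -> R) (K : I -> int -> int -> R)
    (n : nat) :
  (forall i j, measurable [set e | X i e = j]) ->
  (forall a, stochastic (K a)) -> (forall a x, 0 <= w a x) ->
  (forall h : nat -> int,
    mu [set e | forall i, (i <= n)%N -> X i e = h i] =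
    (\sum_a w a (h 0%N) * \prod_(i < n) K a (h i) (h i.+1))%:E) ->
  forall x y, mu [set e | X 0%N e = x /\ X n e = y] =
    (\sum_a w a x * nstep (K a) n x y)%:E.
Proof.
move=> mX KS w0 law x y.
have measA (m : nat) (h : nat -> int) :
    measurable [set e | (forall i, (i <= m)%N -> X i e = h i) /\ X n e = y].
  have -> : [set e | (forall i, (i <= m)%N -> X i e = h i) /\ X n e = y] =
      (\bigcap_(i in [set i | (i <= m)%N]) [set e | X i e = h i]) `&`
      [set e | X n e = y].
    by apply/seteqP; split.
  by apply: measurableI => //; apply: bigcap_measurable => //; exists 0%N.
have claim r : (r <= n)%N -> forall h : nat -> int,
    mu [set e | (forall i, (i <= n - r)%N -> X i e = h i) /\ X n e = y] =
    (\sum_a w a (h 0%N) * \prod_(i < n - r) K a (h i) (h i.+1) *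
       nstep (K a) r (h (n - r)%N) y)%:E.
  elim: r => [_ h|r IH rn h].
    rewrite subn0; have [hn|hn] := eqVneq (h n) y.
      transitivity (mu [set e | forall i, (i <= n)%N -> X i e = h i]).
        congr (mu _); apply/seteqP; split=> e /=; first by case.
        by move=> H; split=> //; rewrite H.
      rewrite law; congr EFin; apply: eq_bigr => a _.
      by rewrite /nstep/= hn eqxx mulr1.
    rewrite (_ : mkset _ = set0); last first.
      apply/seteqP; split=> // e /= [H Xn]; move: hn.
      by rewrite -(H n) ?Xn ?eqxx.
    rewrite measure0 big1// => a _.
    by rewrite /nstep/= (negbTE hn) mulr0.
  have m1 : (n - r = (n - r.+1).+1)%N by lia.
  set m := (n - r.+1)%N in m1 *.
  rewrite (measure_level mu (measA m h) (mX m.+1)).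
  pose h' j i := if i == m.+1 then j else h i.
  have h'E j i : (i <= m)%N -> h' j i = h i.
    by move=> im; rewrite /h' ltn_eqF.
  have h'm j : h' j m.+1 = j by rewrite /h' eqxx.
  have term j : mu ([set e | (forall i, (i <= m)%N -> X i e = h i) /\ X n e = y]
        `&` [set e | X m.+1 e = j]) =
      (\sum_a (w a (h 0%N) * \prod_(i < m) K a (h i) (h i.+1))%:E *
        (K a (h m) j * nstep (K a) r j y)%:E)%E.
    transitivity (mu [set e | (forall i, (i <= n - r)%N -> X i e = h' j i) /\ X n e = y]).
      congr (mu _); apply/seteqP; split=> e /=; rewrite m1.
        move=> [[H Xn] Xm]; split=> // i; rewrite leq_eqVlt => /orP[/eqP ->|im].
          by rewrite /h' eqxx.
        by rewrite h'E// H.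
      move=> [H Xn]; split; last by rewrite H// /h' eqxx.
      by split=> // i im; rewrite H ?h'E// ltnW.
    rewrite IH ?(ltnW rn)// m1 -sumEFin; apply: eq_bigr => a _.
    rewrite -EFinM big_ord_recr/= !h'm (h'E j m)// (h'E j 0%N)// -!mulrA.
    congr (_ * (_ * _))%:E; apply: eq_bigr => i _.
    by rewrite !h'E// ltnW.
  under eq_esum do rewrite term.
  have K0 a i j : 0 <= K a i j by case: (KS a) => + _ => /(_ i j)/ltW.
  have P0 a : 0 <= w a (h 0%N) * \prod_(i < m) K a (h i) (h i.+1).
    by rewrite mulr_ge0// prodr_ge0.
  have N0 a j : 0 <= K a (h m) j * nstep (K a) r j y.
    by rewrite mulr_ge0//; case/andP: (nstep_unit r y (KS a) j).
  rewrite esum_sum; last by move=> j a _ _; rewrite -EFinM lee_fin mulr_ge0.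
  rewrite -sumEFin; apply: eq_bigr => a _.
  rewrite esumZl//; last by move=> j; rewrite lee_fin.
  by rewrite markov_opE//; exact: nstep_unit.
have := claim n (leqnn n) (fun=> x); rewrite subnn.
under [X in _ = X%:E -> _]eq_bigr do rewrite big_ord0 mulr1.
move=> <-; congr (mu _); apply/seteqP; split=> e /= [H Xn]; split=> //.
  by move=> i; rewrite leqn0 => /eqP ->.
exact: H.
Qed.
End PathElimination.

(** * Geodesics and parents in a tree *)

Section Tree.
Context {d : nat} {T : cayleyTree d}.
Implicit Types (x y z w : T) (p : seq T) (L : {fset T}).

Lemma adj_sym x y : adj x y = adj y x.
Proof. exact: nbr_sym. Qed.

Lemma adj_neq x y : adj x y -> x != y.
Proof. by apply: contraTneq => ->; rewrite /adj nbr_irr. Qed.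

Lemma path_rev x p : path adj x p -> path adj (last x p) (rev (belast x p)).
Proof. by rewrite rev_path; apply: sub_path => u v; rewrite adj_sym. Qed.

(** Where two self-avoiding paths with common endpoints first diverge, they
    enclose a cycle with at least three vertices. *)
Lemma geodesic_unique x p1 p2 :
  path adj x p1 -> uniq (x :: p1) -> path adj x p2 -> uniq (x :: p2) ->
  last x p1 = last x p2 -> p1 = p2.
Proof.
elim: p1 x p2 => [|a p1 IH] x [|b p2] //=.
- by move=> _ _ _ + xE; rewrite {1}xE mem_last.
- by move=> _ + _ _ xE; rewrite -{1}xE mem_last.
move=> /andP[xa pa] ua /andP[xb pb] ub E.
have [ab|ab] := eqVneq a b.
  rewrite -{b}ab in xb pb ub E *; congr (_ :: _); apply: IH E => //.
    by case/andP: ua.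
  by case/andP: ub.
exfalso; have hq : has (mem (b :: p2)) (a :: p1).
  by apply/hasP; exists (last a p1); rewrite ?mem_last// E; exact: mem_last.
have [z [s1 [t1 [E1 zp2 hs1]]]] : exists z s1 t1,
    [/\ a :: p1 = rcons s1 z ++ t1, z \in b :: p2 & ~~ has (mem (b :: p2)) s1].
  by case: (split_find hq) => z s1 t1 zp2 hs1; exists z, s1, t1.
have [s2 [t2 E2]] : exists s2 t2, b :: p2 = rcons s2 z ++ t2.
  by case/path.splitP: zp2 => s2 t2; exists s2, t2.
have : path adj x (rcons s1 z).
  have : path adj x (a :: p1) by apply/andP.
  by rewrite E1 cat_path => /andP[].
have : path adj x (rcons s2 z).
  have : path adj x (b :: p2) by apply/andP.
  by rewrite E2 cat_path => /andP[].
move=> /path_rev; rewrite last_rcons belast_rcons rev_cons => ps2 ps1.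
have : uniq (x :: rcons s1 z).
  have : uniq (x :: a :: p1) by [].
  by rewrite E1 -cat_cons cat_uniq => /andP[].
have : uniq (x :: rcons s2 z).
  have : uniq (x :: b :: p2) by [].
  by rewrite E2 -cat_cons cat_uniq => /andP[].
move=> us2 us1.
have disj : ~~ has (mem s2) s1.
  apply: contra hs1 => /hasP[v v1 v2]; apply/hasP; exists v => //=.
  by rewrite E2 mem_cat mem_rcons inE [v \in s2]v2 orbT.
have : ucycle (fun u v => v \in nbr u) (x :: rcons s1 z ++ rev s2).
  rewrite /ucycle; apply/andP; split.
    by rewrite /= rcons_cat cat_path ps1 last_rcons.
  move: us1 us2; rewrite /= !mem_cat !mem_rcons !inE !mem_rev !rcons_uniq.
  rewrite cat_uniq rcons_uniq rev_uniq !negb_or has_rev.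
  move=> /andP[/andP[-> ->] /andP[-> ->]] /andP[/andP[_ ->] /andP[zs2 ->]] /=.
  by rewrite andbT -[has _ _]/(has (mem (rcons s1 z)) s2) has_sym has_rcons negb_or zs2.
move=> /tree_acyclic; rewrite /= size_cat size_rcons size_rev.
case: s1 s2 E1 E2 {ps1 ps2 us1 us2 disj hs1} => [|? ?] [|? ?] //= [az _] [bz _].
by rewrite az bz eqxx in ab.
Qed.

Lemma geodesic_in (P : {pred T}) x p : path adj x p -> all [in P] p ->
  exists q, [/\ path adj x q, uniq (x :: q), last x q = last x p & all [in P] q].
Proof.
move=> xp Pp; case: (shortenP xp) => q xq uq sq; exists q; split=> //.
by apply/allP => v /sq/(allP Pp).
Qed.

Lemma geodesic_exists x y :
  exists q, [/\ path adj x q, uniq (x :: q) & last x q = y].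
Proof.
have [p [xp <-]] := tree_connected x y.
have [q [xq uq qy _]] := geodesic_in (P:=predT) xp (all_predT _).
by exists q.
Qed.

Lemma awayP w x y : reflect
  (exists p, [/\ path adj w (rcons p y), uniq (w :: rcons p y) & last w p = x])
  (away w x y).
Proof. exact: asboolP. Qed.

Lemma away_adj w x y : away w x y -> adj x y.
Proof. by case/awayP => p [+ _ <-]; rewrite rcons_path => /andP[]. Qed.

Lemma away_root w x : away w x w = false.
Proof.
by apply/awayP => -[p [_ + _]]; rewrite /= mem_rcons mem_head.
Qed.

Lemma away_inj w x x' y : away w x y -> away w x' y -> x = x'.
Proof.
case/awayP => p [pp up <-] /awayP[p' [pp' up' <-]].
have := geodesic_unique pp up pp' up'.
by rewrite !last_rcons => /(_ erefl)/rcons_inj[->].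
Qed.

(** The path from [w] to [x] either avoids [y], and then extends to [y], or
    meets [y]; its part after [y] is then the edge from [y] to [x]. *)
Lemma away_total w x y : adj x y -> away w x y || away w y x.
Proof.
move=> xy; have [p [wp up px]] := geodesic_exists w x.
have [yp|yp] := boolP (y \in w :: p); last first.
  apply/orP; left; apply/awayP; exists p; split=> //.
    by rewrite rcons_path wp px.
  by rewrite -rcons_cons rcons_uniq yp.
apply/orP; right; apply/awayP.
case/splitPl: yp wp up px => p1 p2 py; rewrite cat_path => /andP[wp1 yp2].
rewrite last_cat -cat_cons cat_uniq => /and3P[up1 dis up2] p2x.
rewrite py in yp2 p2x; have yp2' : uniq (y :: p2).
  rewrite /= up2 andbT; apply: contra dis => y2; apply/hasP; exists y => //=.
  by rewrite -py mem_last.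
have p2E : p2 = [:: x].
  apply: (geodesic_unique yp2 yp2') => //; first by rewrite /= adj_sym xy.
  by rewrite /= inE eq_sym adj_neq.
exists p1; split=> //; first by rewrite rcons_path wp1 py adj_sym.
rewrite -rcons_cons rcons_uniq up1 andbT.
by move: dis; rewrite p2E /= orbF.
Qed.

Lemma away_asym w x y : away w x y -> ~~ away w y x.
Proof.
case/awayP => p [pp up px]; apply/awayP => -[p' [pp' up' py]].
have [wp _] : path adj w p /\ adj (last w p) y.
  by apply/andP; rewrite -rcons_path.
move: up; rewrite -rcons_cons rcons_uniq => /andP[yp up].
have E : p = rcons p' x.
  by apply: geodesic_unique wp up pp' up' _; rewrite last_rcons.
move: yp; rewrite E -rcons_cons mem_rcons inE negb_or => /andP[_].
by rewrite -py mem_last.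
Qed.

(** The neighbour of [y] on the way to [w]; a default value if [y = w]. *)
Definition parent w y : T := xget y [set x | away w x y].

Lemma away_parent w y : y != w -> away w (parent w y) y.
Proof.
move=> yw; have [x xy] : exists x, away w x y.
  have [q [wq uq qy]] := geodesic_exists w y.
  case/lastP: q wq uq qy => [|q z]; first by move=> _ _ /= wy; rewrite wy eqxx in yw.
  rewrite last_rcons => wq uq zy; exists (last w q); apply/awayP; exists q.
  by rewrite -zy.
rewrite /parent; case: xgetP => [z ->//|/(_ x)].
by rewrite /= xy.
Qed.

Lemma awayE w x y : away w x y = (y != w) && (x == parent w y).
Proof.
have [->|yw] := eqVneq y w; first by rewrite away_root.
apply/idP/eqP => [xy|->]; last exact: away_parent.
exact: away_inj xy (away_parent yw).
Qed.

Lemma parent_adj w y : y != w -> adj (parent w y) y.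
Proof. by move/away_parent/away_adj. Qed.

Section Products.
Context {R : comRingType}.

Lemma prod_away (A E : seq T) w (G : T -> T -> R) : uniq A ->
  (forall y, y \in E -> y != w -> parent w y \in A) ->
  \prod_(x <- A) \prod_(y <- E | away w x y) G x y =
  \prod_(y <- E | y != w) G (parent w y) y.
Proof.
move=> uA pA; rewrite (exchange_big_dep xpredT)//= [RHS]big_mkcond/=.
rewrite !big_seq; apply: eq_bigr => y yE; case: ifPn => [yw|]; last first.
  by rewrite negbK => /eqP ->; rewrite big1// => x; rewrite away_root.
under eq_bigl do rewrite awayE yw /=.
rewrite big_mkcond/= (bigD1_seq (parent w y)) ?pA//= eqxx big1 ?mulr1// => x.
by move=> /negbTE ->.
Qed.
End Products.
End Tree.

(** * Finite subtrees and paths *)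

Section Subtrees.
Context {d : nat} {T : cayleyTree d}.
Implicit Types (x y z v w : T) (p : seq T) (L : {fset T}).

Lemma mem_outer_boundary L y :
  reflect (y \notin L /\ exists2 x, x \in L & adj x y) (y \in outer_boundary L).
Proof.
rewrite in_fsetD; apply: (iffP andP) => [[yL /bigfcupP[x /andP[xL _] xy]]|[yL [x xL xy]]].
  by split=> //; exists x.
by split=> //; apply/bigfcupP; exists x; rewrite // xL.
Qed.

Lemma connected_parent L w y : connected_in L -> w \in L -> y \in L ->
  y != w -> parent w y \in L.
Proof.
move=> [_ cL] wL yL yw; have [p [wp pL py]] := cL _ _ wL yL.
have [q [wq uq qy qL]] := geodesic_in wp pL.
case/lastP: q wq uq qy qL => [|q z]; 
  first by rewrite py /= => _ _ wy; rewrite wy eqxx in yw.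
rewrite last_rcons py => wq uq zy; rewrite zy in wq uq *.
rewrite all_rcons => /andP[_ qL].
suff <- : last w q = parent w y.
  by have := mem_last w q; rewrite inE => /orP[/eqP->//|/(allP qL)].
apply: away_inj (away_parent yw); apply/awayP; exists q; split=> //.
Qed.

(** A geodesic inside the set from the root to a neighbour of [y] extends to [y]. *)
Lemma boundary_parent L w y : connected_in L -> w \in L ->
  y \in outer_boundary L -> parent w y \in L.
Proof.
move=> [_ cL] wL /mem_outer_boundary[yL [x xL xy]].
have [p [wp pL px]] := cL _ _ wL xL.
have [q [wq uq qx qL]] := geodesic_in wp pL.
have yw : y != w by apply: contraNneq yL => ->.
suff <- : x = parent w y by [].
apply: away_inj (away_parent yw); apply/awayP; exists q; split=> //.
- by rewrite rcons_path wq qx px.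
- rewrite -rcons_cons rcons_uniq uq andbT inE negb_or yw.
  by apply: contra yL => /(allP qL).
- by rewrite qx.
Qed.

(** Every vertex of a connected set or of its boundary, except the root, is the
    child of exactly one vertex of the set; a vertex has [d] children, and the
    root one more. *)
Lemma prod_parent (R : comRingType) L w (H : T -> R) :
  connected_in L -> w \in L ->
  \prod_(y <- (L `|` outer_boundary L)%fset | y != w) H (parent w y) =
  \prod_(v <- L) H v ^+ (d + (v == w)).
Proof.
move=> cL wL; set E := (L `|` outer_boundary L)%fset.
rewrite -(prod_away (A:=L) (fun x _ => H x)) ?fset_uniq//; last first.
  move=> y /fsetUP[yL yw|yB _]; first exact: connected_parent.
  exact: boundary_parent.
rewrite !big_seq; apply: eq_bigr => v vL.
rewrite big_const_seq iter_mulr_1; congr (_ ^+ _).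
have -> : count (away w v) E = count (away w v) (nbr v).
  rewrite -!size_filter; apply/perm_size/uniq_perm; rewrite ?filter_uniq ?fset_uniq// => y.
  rewrite !mem_filter; have [vy|//] := boolP (away w v y).
  have yv : y \in nbr v := away_adj vy.
  rewrite yv; apply/fsetUP; have [yL|yL] := boolP (y \in L); [by left|right].
  by apply/mem_outer_boundary; split=> //; exists v.
have sz : size (nbr v) = d.+1 by exact: nbr_card.
have away_nbr y : y \in nbr v -> away w v y = ~~ away w y v.
  move=> vy; have := away_total w (vy : adj v y).
  by case: (boolP (away w v y)) => [/away_asym ->//|_ /= ->].
rewrite (eq_in_count away_nbr).
have [vw|vw] := eqVneq v w.
  rewrite addn1 -[RHS]sz -(count_predT (nbr v)).
  by apply: eq_count => y; rewrite vw away_root.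
have := count_predC (fun y => away w y v) (nbr v); rewrite sz addn0.
have -> : count (fun y => away w y v) (nbr v) = 1%N.
  rewrite (eq_count (a2:=pred1 (parent w v))) => [|y]; last by rewrite awayE vw.
  rewrite count_uniq_mem ?fset_uniq// -[_ \in _]/(adj v _) adj_sym.
  by rewrite parent_adj.
by rewrite add1n => -[].
Qed.

(** Both squares are the product over all ordered pairs of neighbours. *)
Lemma prod_edges_root (R : realType) (E : seq T) (S : rel T) (g : T -> T -> R) o w :
  (forall x y, 0 < g x y) -> (forall x y, g x y = g y x) ->
  (forall x y, S x y = S y x) ->
  \prod_(x <- E) \prod_(y <- E | away o x y && S x y) g x y =
  \prod_(x <- E) \prod_(y <- E | away w x y && S x y) g x y.
Proof.
move=> g0 gC SC.
have sqr r : (\prod_(x <- E) \prod_(y <- E | away r x y && S x y) g x y) ^+ 2 =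
    \prod_(x <- E) \prod_(y <- E | adj x y && S x y) g x y.
  rewrite expr2 {2}(exchange_big_dep xpredT)//= -big_split/=.
  apply: eq_bigr => x _; rewrite [RHS](bigID (away r x))/=; congr (_ * _).
    apply: eq_bigl => y; have [xy|] := boolP (away r x y); last by rewrite andbF.
    by rewrite (away_adj xy) andbT.
  under eq_bigr do rewrite gC; apply: eq_bigl => y; rewrite SC.
  case: (S x y); rewrite ?andbF ?andbT//.
  apply/idP/andP => [yx|[xy nxy]]; first by rewrite adj_sym (away_adj yx) away_asym.
  by have := away_total r xy; rewrite (negbTE nxy).
have pos r : 0 <= \prod_(x <- E) \prod_(y <- E | away r x y && S x y) g x y.
  by do 2![apply: prodr_ge0 => ? _]; exact: ltW.
by apply/eqP; rewrite -(eqrXn2 (n:=2))// !sqr.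
Qed.

Lemma prod_fset_pairs (R : comRingType) (L : {fset T}) (P : rel T) (G : T -> T -> R) :
  \prod_(b : L * L | P (val b.1) (val b.2)) G (val b.1) (val b.2) =
  \prod_(x <- L) \prod_(y <- L | P x y) G x y.
Proof.
rewrite big_seq_fsetE/=; under [RHS]eq_bigr do rewrite big_seq_fsetE/=.
by rewrite pair_big_dep.
Qed.

Lemma connected_path x p : path adj x p -> connected_in [fset v in x :: p]%fset.
Proof.
move=> xp; have memL v : (v \in [fset u in x :: p]%fset) = (v \in x :: p).
  by rewrite in_fset.
split; first by apply/fset0Pn; exists x; rewrite memL mem_head.
have to v : v \in x :: p -> exists q,
    [/\ path adj x q, {subset q <= x :: p} & last x q = v].
  move=> vp; case/splitPl: vp xp => p1 p2 E; rewrite cat_path => /andP[xp1 _].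
  by exists p1; split=> // u up1; rewrite -cat_cons mem_cat inE up1 orbT.
move=> u v; rewrite !memL => /to[q [xq qp qu]] /to[q' [xq' qp' qv]].
exists (rev (belast x q) ++ q'); split.
- by rewrite -qu cat_path path_rev//=; case: (lastP q) => [//|s z];
    rewrite last_rcons belast_rcons rev_cons last_rcons.
- rewrite all_cat; apply/andP; split; apply/allP => t tq /=; rewrite memL.
    move: tq; rewrite mem_rev => /mem_belast; rewrite inE => /orP[/eqP ->|/qp//].
    exact: mem_head.
  exact: qp'.
- rewrite last_cat; case: (lastP q) qu => [<-//|s z _].
  by rewrite belast_rcons rev_cons last_rcons.
Qed.

Lemma parent_path w p i : path adj w p -> uniq (w :: p) -> (i < size p)%N ->
  nth w p i != w /\ parent w (nth w p i) = nth w (w :: p) i.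
Proof.
move=> wp up ip; have xw : nth w p i != w.
  apply: contraTneq up => xw; rewrite cons_uniq negb_and negbK; apply/orP; left.
  by rewrite -[X in X \in _]xw mem_nth.
split=> //; apply: away_inj (away_parent xw) _; apply/awayP; exists (take i p); split.
- by rewrite -take_nth// take_path.
- by rewrite -take_nth//; exact: (take_uniq i.+2 up).
- rewrite (last_nth w) size_takel ?(ltnW ip)//.
  by case: i ip {xw} => //= i ip; rewrite nth_take.
Qed.

Lemma prod_path (R : comRingType) w p (G : T -> T -> R) :
  path adj w p -> uniq (w :: p) ->
  \prod_(y <- [fset v in w :: p]%fset | y != w) G (parent w y) y =
  \prod_(i < size p) G (nth w (w :: p) i) (nth w p i).
Proof.
move=> wp up; have pE : perm_eq [fset v in w :: p]%fset (w :: p).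
  by apply: uniq_perm => // y; rewrite in_fset.
rewrite (perm_big _ pE) big_cons eqxx/= (big_nth w) big_mkord.
rewrite [LHS]big_mkcond/=; apply: eq_bigr => i _.
by have [-> ->] := parent_path wp up (ltn_ord i).
Qed.

(** A path extends at its head by any neighbour other than the next vertex: were
    this neighbour on the path, the path up to it and the edge to it would be two
    geodesics. *)
Lemma tree_path_exists (o : T) n : (1 <= d)%N -> exists p : seq T, tree_path n p.
Proof.
move=> d1; suff [x [p [xp up sp]]] : exists x p,
    [/\ path adj x p, uniq (x :: p) & size p = n].
  by exists (x :: p); apply/and3P; split=> //; rewrite /= sp.
elim: n => [|n [x [p [xp up sp]]]]; first by exists o, [::].
have [z] : exists z, z \in (nbr x `\ head x p)%fset.
  apply/fset0Pn; rewrite -cardfs_gt0.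
  have := cardfsD1 (head x p) (nbr x); rewrite nbr_card; case: (_ \in _) => /=; lia.
rewrite !inE => /andP[zp xz]; exists z, (x :: p); split; last by rewrite /= sp.
  by rewrite /= xp andbT adj_sym.
rewrite cons_uniq up andbT inE negb_or eq_sym (adj_neq xz)/=.
apply/negP => zip; have {}zip : z \in x :: p by rewrite inE zip orbT.
case/splitPl: zip xp up zp {sp} => p1 p2 p1z; rewrite cat_path => /andP[xp1 _] up.
have {}up : uniq (x :: p1) by move: up; rewrite -cat_cons cat_uniq => /andP[].
have -> : p1 = [:: z]; last by rewrite /= eqxx.
apply: (geodesic_unique xp1 up) => //; first by rewrite /= andbT.
by rewrite /= inE (adj_neq xz).
Qed.
End Subtrees.

(** * The Gibbs measure as a tree-indexed Markov chain *)

Section Marginals.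
Context {R : realType} {d0 : measure_display} {W : measurableType d0}
  {I : choiceType}.
Implicit Types (X : I -> W -> int) (t : I -> int) (s : seq I).

Lemma measurable_cylinder X s t :
  (forall i j, measurable [set e | X i e = j]) ->
  measurable [set e | forall i, i \in s -> X i e = t i].
Proof.
move=> mX; elim: s => [|i s IH].
  by rewrite (_ : mkset _ = setT)// eqEsubset.
have -> : [set e | forall k, k \in i :: s -> X k e = t k] =
    [set e | X i e = t i] `&` [set e | forall k, k \in s -> X k e = t k].
  apply/seteqP; split=> e /=.
    by move=> H; split=> [|k ks]; apply: H; rewrite inE ?eqxx ?ks ?orbT.
  by move=> [Hi H] k; rewrite inE => /orP[/eqP ->|/H].
exact: measurableI.
Qed.

(** Removing leaves from a tree-indexed Markov chain: the transition
    probabilities out of the parent of a leaf sum to one. *)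
Lemma prune_leaves (mu : {measure set W -> \bar R}) X (K : int -> int -> R)
    (s ys : seq I) (par : I -> I) (f : (I -> int) -> R) :
  (forall i j, measurable [set e | X i e = j]) -> stochastic K ->
  uniq ys -> (forall y, y \in ys -> y \notin s) ->
  (forall y, y \in ys -> par y \in s) ->
  (forall t, 0 <= f t) ->
  (forall t t', (forall i, i \in s -> t i = t' i) -> f t = f t') ->
  (forall t, mu [set e | forall i, i \in s ++ ys -> X i e = t i] =
    (f t * \prod_(y <- ys) K (t (par y)) (t y))%:E) ->
  forall t, mu [set e | forall i, i \in s -> X i e = t i] = (f t)%:E.
Proof.
move=> mX KS + + + f0 floc; elim: ys => [_ _ _ law t|y ys IH].
  by rewrite -[in LHS](cats0 s) law big_nil mulr1.
move=> /= /andP[yys uys] ys_s pars law; have [K0 _] := KS; apply: IH => // [z zs|z zs|t].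
- by apply: ys_s; rewrite inE zs orbT.
- by apply: pars; rewrite inE zs orbT.
have ys' : y \notin s by apply: ys_s; rewrite mem_head.
have pary : par y \in s by apply: pars; rewrite mem_head.
rewrite (measure_level mu (measurable_cylinder _ _ mX) (mX y)).
pose t' j i := if i == y then j else t i.
have t's j i : i \in s -> t' j i = t i.
  by move=> si; rewrite /t' ifN//; apply: contraNneq ys' => <-.
have term j : mu ([set e | forall i, i \in s ++ ys -> X i e = t i] `&`
      [set e | X y e = j]) =
    ((f t * \prod_(z <- ys) K (t (par z)) (t z))%:E * (K (t (par y)) j * 1)%:E)%E.
  transitivity (mu [set e | forall i, i \in s ++ y :: ys -> X i e = t' j i]).
    congr (mu _); apply/seteqP; split=> e /=.
      move=> [H yj] i; rewrite mem_cat inE orbCA -mem_cat /t'.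
      by case: eqP => [->//|_ /=]; exact: H.
    move=> H; split=> [i|]; last by rewrite H ?mem_cat ?mem_head ?orbT// /t' eqxx.
    move=> si; rewrite H; last first.
      by rewrite mem_cat inE orbCA -mem_cat si orbT.
    rewrite /t' ifN//; apply: contraTneq si => ->.
    by rewrite mem_cat negb_or ys'.
  rewrite law -EFinM mulr1 big_cons (floc _ t)//; last by move=> i; exact: t's.
  rewrite t's// {1}/t' eqxx -mulrA; congr (_ * _)%:E; rewrite mulrC; congr (_ * _).
  rewrite !big_seq; apply: eq_bigr => z zys.
  rewrite t's; last by apply: pars; rewrite inE zys orbT.
  by rewrite /t' ifN//; apply: contraNneq yys => <-.
under eq_esum do rewrite term.
rewrite esumZl; last 2 first.
- rewrite mulr_ge0// prodr_ge0// => z _; exact: ltW.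
- by move=> j; rewrite lee_fin mulr1 ltW.
under eq_esum do rewrite mulr1.
by have [_ ->] := KS; rewrite mule1.
Qed.
End Marginals.

Section GibbsTree.
Context {R : realType} {d : nat} {T : cayleyTree d}.
Variables (Q lam : int -> R) (M c : R).
Hypothesis hQ : transfer_operator Q.
Hypothesis lam0 : forall i, 0 < lam i.
Hypothesis lamM : forall i, lam i <= M.
Hypothesis c0 : 0 < c.
Hypothesis lamE : forall i, lam i = c * Qconv Q lam i ^+ d.

Let K := gibbs_kernel Q lam.
Let Q0 i : 0 < Q i. Proof. by case: hQ. Qed.
Let Qsym i : Q (- i) = Q i. Proof. by case: hQ. Qed.

(** The Gibbs weight on a connected set and its boundary is that of a Markov
    chain indexed by the tree and started at [w]: the normalizations
    [Qconv Q lam] of the transitions out of a vertex occur once for each child,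
    and the boundary law equation turns their product into [lam]. *)
Lemma gibbs_weight_chain (o w : T) (L : {fset T}) (t : T -> int) :
  connected_in L -> w \in L ->
  gibbs_weight o Q lam (L := L) [ffun y => t (val y)] =
  c ^- #|` L| * (lam (t w) * Qconv Q lam (t w)) *
  \prod_(y <- (L `|` outer_boundary L)%fset | y != w)
    K (t (parent w y)) (t y).
Proof.
move=> cL wL; set E := (L `|` outer_boundary L)%fset.
have u0 i : Qconv Q lam i != 0 by rewrite gt_eqF// (Qconv_gt0 hQ lam0 lamM).
have uE : uniq E by exact: fset_uniq.
have pL y : y \in E -> y != w -> parent w y \in L.
  move=> /fsetUP[yL yw|yB _]; first exact: connected_parent.
  exact: boundary_parent.
have lamP : lam (t w) * \prod_(y <- E | y != w) lam (t y) =
    (\prod_(y <- L) lam (t y)) * \prod_(y <- E | y \in outer_boundary L) lam (t y).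
  rewrite -(bigD1_seq w)//=; last by rewrite in_fsetU wL.
  rewrite (bigID (mem (outer_boundary L)))/= mulrC; congr (_ * _).
  rewrite -big_filter; apply: perm_big; apply: uniq_perm.
  - exact: filter_uniq.
  - exact: fset_uniq.
  move=> y; rewrite mem_filter /= in_fsetU andbC andb_orl andbN orbF.
  by apply: andb_idr => yL; apply/negP => /mem_outer_boundary[]; rewrite yL.
have edges : \prod_(b : E * E | away o (val b.1) (val b.2) &&
      ((val b.1 \in L) || (val b.2 \in L))) Q (t (val b.1) - t (val b.2)) =
    \prod_(y <- E | y != w) Q (t (parent w y) - t y).
  rewrite (prod_fset_pairs E (fun x y => away o x y && ((x \in L) || (y \in L)))
    (fun x y => Q (t x - t y))).
  rewrite (prod_edges_root (S:=fun x y => (x \in L) || (y \in L)) _ o w)//.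
  - rewrite -(prod_away (A:=E) (fun x y => Q (t x - t y)))//; last first.
      by move=> y yE yw; rewrite in_fsetU pL.
    rewrite [LHS]big_seq [RHS]big_seq; apply: eq_bigr => x xE.
    rewrite [LHS]big_seq_cond [RHS]big_seq_cond; apply: eq_bigl => y; 
    have [yE /=|//] := boolP (y \in E).
    have [|//] := boolP (away w x y); rewrite awayE => /andP[yw /eqP ->].
    by rewrite pL.
  - by move=> x y; rewrite -Qsym opprB.
  - by move=> x y; rewrite orbC.
have -> : gibbs_weight o Q lam (L := L) [ffun y => t (val y)] =
    (\prod_(y <- E | y \in outer_boundary L) lam (t y)) *
    \prod_(y <- E | y != w) Q (t (parent w y) - t y).
  rewrite -edges /gibbs_weight; congr (_ * _).
    rewrite [RHS]big_seq_fsetE/=; apply: eq_bigr => y _; by rewrite ffunE.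
  by apply: eq_bigr => b _; rewrite !ffunE.
rewrite /K /gibbs_kernel prodf_div big_split/=.
rewrite (prod_parent (fun v => Qconv Q lam (t v)))//.
have -> : \prod_(v <- L) Qconv Q lam (t v) ^+ (d + (v == w)) =
    Qconv Q lam (t w) * \prod_(v <- L) Qconv Q lam (t v) ^+ d.
  under eq_bigr do rewrite exprD; rewrite big_split/= mulrC; congr (_ * _).
  rewrite (bigD1_seq w)//= eqxx big1 ?mulr1// => v /negbTE ->.
  by rewrite expr0.
have lamL : \prod_(v <- L) lam (t v) =
    c ^+ #|` L| * \prod_(v <- L) Qconv Q lam (t v) ^+ d.
  under eq_bigr do rewrite lamE; rewrite big_split/= big_const_seq count_predT.
  by rewrite iter_mulr_1.
set U := \prod_(v <- L) Qconv Q lam (t v) ^+ d in lamL *.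
have U0 : U != 0 by rewrite prodf_seq_neq0; apply/allP => v _; rewrite expf_neq0.
have c1 : c ^+ #|` L| != 0 by rewrite expf_neq0// gt_eqF.
transitivity (c ^- #|` L| * (\prod_(y <- E | y != w) Q (t (parent w y) - t y) *
    (lam (t w) * \prod_(y <- E | y != w) lam (t y)) / U)).
  by rewrite lamP lamL; field; rewrite U0 c1.
by field; rewrite u0 U0 c1.
Qed.

Lemma measurable_height (v : T) (k : int) :
  measurable [set sigma : heights T | sigma v = k].
Proof. by apply: sub_sigma_algebra; exists v, k. Qed.

(** The transition probabilities into the boundary sum to one, so the boundary
    disappears from the chain of [gibbs_weight_chain]. *)
Lemma gibbs_tree_law (o w : T) (L : {fset T}) (mu : probability (heights T) R) :
  gibbs_marginals o Q lam mu -> connected_in L -> w \in L ->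
  exists2 C, 0 <= C & forall t : T -> int,
    mu [set sigma : heights T | forall v, v \in L -> sigma v = t v] =
    (C * (lam (t w) * Qconv Q lam (t w)) *
      \prod_(y <- L | y != w) K (t (parent w y)) (t y))%:E.
Proof.
move=> mumu cL wL; have KS : stochastic K := gibbs_kernel_stochastic hQ lam0 lamM.
have K0 i j : 0 < K i j by case: KS.
pose Z := partition_function o Q lam L.
have Z0 : 0 <= Z.
  apply/fine_ge0/esum_ge0 => s _; rewrite lee_fin /gibbs_weight.
  by apply: mulr_ge0; apply: prodr_ge0 => *; exact: ltW.
have C0 : 0 <= Z^-1 * c ^- #|` L|.
  by rewrite mulr_ge0 ?invr_ge0 ?exprn_ge0// ltW.
exists (Z^-1 * c ^- #|` L|) => //.
set B := outer_boundary L.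
have EE : perm_eq (L `|` B)%fset (L ++ B).
  apply: uniq_perm => [||y]; [exact: fset_uniq| |by rewrite mem_cat in_fsetU].
  rewrite cat_uniq !fset_uniq andbT/=; apply/hasPn => y.
  by move=> /mem_outer_boundary[].
have Bw y : y \in B -> y != w.
  by move=> /mem_outer_boundary[yL _]; apply: contraNneq yL => ->.
apply: (prune_leaves (X:=fun v (sigma : heights T) => sigma v) (s:=L) (ys:=B)
    (par:=parent w) (K:=K)) => //.
- exact: measurable_height.
- by move=> y /mem_outer_boundary[].
- by move=> y; exact: boundary_parent.
- move=> t; apply: mulr_ge0; last by apply: prodr_ge0 => *; exact: ltW.
  by apply: mulr_ge0 => //; rewrite mulr_ge0// ltW// (Qconv_gt0 hQ lam0 lamM).
- move=> t t' tt'; rewrite tt'//; congr (_ * _).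
  rewrite big_seq_cond [RHS]big_seq_cond; apply: eq_bigr => y /andP[yL yw].
  by rewrite !tt'//; exact: connected_parent.
move=> t; have := mumu L [ffun y => t (val y)] cL; rewrite (gibbs_weight_chain _ _ cL wL).
rewrite (perm_big _ EE) big_cat/=.
have -> : \prod_(y <- B | y != w) K (t (parent w y)) (t y) =
    \prod_(y <- B) K (t (parent w y)) (t y).
  rewrite big_seq_cond [RHS]big_seq; apply: eq_bigl => y.
  by have [/Bw ->|] := boolP (y \in B).
rewrite !mulrA => <-; congr (mu _); apply/seteqP; split=> sigma /= H.
  by move=> y; rewrite ffunE; apply: H; rewrite -(perm_mem EE); exact: fsvalP.
move=> y; rewrite -(perm_mem EE) => yE.
by have := H [` yE]%fset; rewrite ffunE.
Qed.

Lemma gibbs_path_law (o w : T) (p : seq T) (mu : probability (heights T) R) :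
  gibbs_marginals o Q lam mu -> path adj w p -> uniq (w :: p) ->
  exists2 C, 0 <= C & forall x y,
    mu [set sigma : heights T | sigma w = x /\ sigma (last w p) = y] =
    (C * (lam x * Qconv Q lam x) * nstep K (size p) x y)%:E.
Proof.
move=> mumu wp up; have KS : stochastic K := gibbs_kernel_stochastic hQ lam0 lamM.
have wL : w \in [fset v in w :: p]%fset by rewrite in_fset mem_head.
have [C C0 law] := gibbs_tree_law mumu (connected_path wp) wL.
exists C => // x y.
have := nth_last w (w :: p); rewrite /= => <-.
rewrite (path_elimination (X:=fun i (sigma : heights T) => sigma (nth w (w :: p) i))
  (w:=fun (_ : 'I_1) z => C * (lam z * Qconv Q lam z)) (K:=fun=> K) (n:=size p))//.
- by rewrite big_ord1.
- by move=> i j; exact: measurable_height.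
- by move=> _ z; rewrite !mulr_ge0// ltW// (Qconv_gt0 hQ lam0 lamM).
move=> h; rewrite big_ord1.
pose t v := h (index v (w :: p)).
have tn i : (i <= size p)%N -> t (nth w (w :: p) i) = h i.
  by move=> ip; rewrite /t index_uniq.
transitivity (mu [set sigma : heights T | forall v, v \in [fset v in w :: p]%fset ->
    sigma v = t v]).
  congr (mu _); apply/seteqP; split=> sigma /= H.
    move=> v; rewrite in_fset => vp.
    by rewrite -[in LHS](nth_index w vp) H// -ltnS index_mem.
  by move=> i ip; rewrite H ?tn// in_fset mem_nth.
rewrite law (prod_path (fun x y => K (t x) (t y)) wp up) -(tn 0%N)//.
congr (_ * _)%:E; apply: eq_bigr => i _.
by rewrite -(tn i) ?(ltnW (ltn_ord i))// -(tn i.+1).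
Qed.

(** The total mass of [mu] fixes the constants of all paths, since the height at
    the end of a path has the law given by the path of length zero. *)
Lemma gibbs_two_point (o w : T) (p : seq T) (S : R)
    (mu : probability (heights T) R) :
  \esum_(j in [set: int]) (lam j * Qconv Q lam j)%:E = S%:E ->
  gibbs_marginals o Q lam mu -> path adj w p -> uniq (w :: p) ->
  forall x y, mu [set sigma : heights T | sigma w = x /\ sigma (last w p) = y] =
    (S^-1 * (lam x * Qconv Q lam x) * nstep K (size p) x y)%:E.
Proof.
move=> SE mumu wp up x y.
have KS : stochastic K := gibbs_kernel_stochastic hQ lam0 lamM.
have piS : stationary K (fun i => lam i * Qconv Q lam i).
  exact: gibbs_kernel_stationary hQ lam0 lamM.
have [pi0 _] := piS.
have single v z : mu [set sigma : heights T | sigma v = z] =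
    (S^-1 * (lam z * Qconv Q lam z))%:E.
  have [C C0 law] := @gibbs_path_law o v [::] mu mumu isT isT.
  have {}law j : mu [set sigma : heights T | sigma v = j] =
      (C * (lam j * Qconv Q lam j))%:E.
    have := law j j; rewrite /nstep/= eqxx mulr1 => <-.
    by congr (mu _); apply/seteqP; split=> s /= => [->|[]].
  have : 1%E = \esum_(j in [set: int]) 
      mu (setT `&` [set sigma : heights T | sigma v = j]).
    rewrite -(probability_setT mu).
    exact: measure_level measurableT (measurable_height v).
  under eq_esum do rewrite setTI law EFinM.
  rewrite esumZl//; last by move=> j; rewrite lee_fin ltW.
  rewrite SE law -EFinM => -[C1]; congr (_ * _)%:E.
  have S0 : S != 0 by apply: contraPneq C1 => ->; rewrite mulr0 => /eqP; rewrite oner_eq0.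
  by rewrite -[C](mulfK S0) -C1 mul1r.
have [C C0 law] := gibbs_path_law mumu wp up.
rewrite law; congr (_ * _ * _)%:E.
have : mu [set sigma : heights T | sigma (last w p) = 0] = \esum_(j in [set: int])
    mu ([set sigma : heights T | sigma (last w p) = 0] `&`
      [set sigma : heights T | sigma w = j]).
  exact: measure_level (measurable_height (last w p) 0) (measurable_height w).
rewrite single; have step j : mu ([set sigma : heights T | sigma (last w p) = 0] `&`
    [set sigma : heights T | sigma w = j]) =
    (C%:E * ((lam j * Qconv Q lam j) * nstep K (size p) j 0)%:E)%E.
  by rewrite -EFinM mulrA -law; congr (mu _); apply/seteqP; split=> s /= [].
under eq_esum do rewrite step.
rewrite esumZl//; last first.
  by move=> j; rewrite lee_fin mulr_ge0 ?(ltW (pi0 j))//;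
    case/andP: (nstep_unit (size p) 0 KS j).
rewrite (nstep_stationary _ _ KS piS) -EFinM => -[].
by move/(mulIf (lt0r_neq0 (pi0 0))).
Qed.
End GibbsTree.

(** * The localized law and its increments *)

Section Localized.
Context {R : realType}.
Variables (d : nat) (Q x : int -> R) (eps : R).
Hypothesis hQ : transfer_operator Q.
Hypothesis hx : localized_fixpoint d Q eps x.

(** The fixed point with its omitted value at [0] restored, so that [lam] is the
    [d]-th power of [y] everywhere. *)
Let y (j : int) : R := if j == 0 then 1 else x j.
Let lam (j : int) : R := y j ^+ d.

Let Q0 i : 0 < Q i. Proof. by case: hQ. Qed.

Let x0 j : j != 0 -> 0 <= x j. Proof. by case: hx => + _ _; exact. Qed.

Let y_nonzero j : nonzero j -> y j = x j.
Proof. by rewrite /nonzero/= /y => /negbTE ->. Qed.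

Let y_gt0 j : 0 < y j.
Proof.
rewrite /y; case: ifPn => // j0; case: hx => _ _ fx.
rewrite -(fx _ j0) /Tmap.
have s0 (f : int -> R) : (forall j, 0 <= f j) ->
    0 <= sumZ nonzero (fun j => f j * `|x j| ^+ d).
  by move=> f0; apply: sumZ_ge0 => i _; rewrite mulr_ge0.
rewrite divr_gt0//; last by rewrite ltr_wpDr// s0// => i; exact: ltW.
by rewrite ltr_wpDr// s0// => i; exact: ltW.
Qed.

Lemma esum_nonzero (f : int -> R) : (forall j, 0 <= f j) ->
  \esum_(j in [set: int]) (f j)%:E =
  ((f 0)%:E + \esum_(j in nonzero) (f j)%:E)%E.
Proof.
move=> f0; rewrite (esumID nonzero) ?setTI => [|j _]; last by rewrite lee_fin.
rewrite addeC; congr (_ + _)%E.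
rewrite (_ : ~` nonzero = [set 0]) ?esum_set1 ?lee_fin//.
apply/seteqP; split=> j; rewrite /nonzero/=; last by move=> ->; rewrite eqxx.
by move/negP; rewrite negbK => /eqP.
Qed.

Let powsum : exists S, \esum_(j in [set: int]) (y j ^+ d.+1)%:E = S%:E.
Proof.
have y0 j : 0 <= y j ^+ d.+1 by rewrite exprn_ge0// ltW.
have E : \esum_(j in nonzero) (y j ^+ d.+1)%:E =
    \esum_(j in nonzero) (`|x j| `^ d.+1%:R)%:E.
  apply: eq_esum => j j0; rewrite powR_mulrn// ger0_norm ?x0// y_nonzero//.
have : (\esum_(j in nonzero) (y j ^+ d.+1)%:E < +oo)%E.
  rewrite ltey E; apply/eqP => H; case: hx => _ + _.
  by rewrite /lpnorm H poweRyr ?invr_eq0 ?pnatr_eq0// leye_eq.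
move=> /(sumZ_EFin (fun j _ => y0 j)) sE.
by rewrite esum_nonzero// sE -EFinD; eexists.
Qed.

Let lam_gt0 j : 0 < lam j. Proof. by rewrite exprn_gt0. Qed.

Let lam_bound : exists M, forall j, lam j <= M.
Proof.
have [S SE] := powsum; exists (1 + S) => j.
have yS : y j ^+ d.+1 <= S.
  rewrite -lee_fin -SE; apply: (esum_ge_term (a:=fun j => (y j ^+ d.+1)%:E)) => i.
  by rewrite lee_fin exprn_ge0// ltW.
have S0 : 0 <= S by apply: le_trans yS; rewrite exprn_ge0// ltW.
rewrite /lam; have [y1|/ltW y1] := leP (y j) 1.
  by apply: (@le_trans _ _ 1); rewrite ?lerDl// exprn_ile1// ltW.
apply: (@le_trans _ _ (y j ^+ d.+1)); last by lra.
by rewrite exprS ler_peMl// exprn_ge0// ltW.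
Qed.

Let u := Qconv Q lam.

Let Tmap_nonzero i : Q i + sumZ nonzero (fun j => Q (i - j) * `|x j| ^+ d) = u i.
Proof.
have [M lamM] := lam_bound.
have QE := QconvE hQ lam_gt0 lamM i.
have T0 j : 0 <= Q (i - j) * lam j by rewrite mulr_ge0// ltW.
have lam00 : lam 0 = 1 by rewrite /lam /y eqxx expr1n.
have := esum_nonzero T0; rewrite QE subr0 lam00 mulr1.
rewrite /u sumZ_EFin// => [[->]|]; last first.
  apply: (@le_lt_trans _ _ (u i)%:E); last by rewrite ltry.
  by rewrite -QE esum_nonzero// leeDr// lee_fin.
rewrite /sumZ; congr (_ + fine _); apply: eq_esum => j j0.
by rewrite ger0_norm ?x0// /lam y_nonzero.
Qed.

(** The fixed-point equation says that [y] is proportional to [Qconv Q lam], which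
    is the boundary law equation for [lam]; it turns the stationary weights
    [lam j * Qconv Q lam j] into multiples of the summable [y j ^+ d.+1]. *)
Lemma localized_law_props (i : int) : exists M c S,
  [/\ forall j, 0 < localized_law d x i j,
      forall j, localized_law d x i j <= M,
      0 < c /\ (forall j, localized_law d x i j =
                    c * Qconv Q (localized_law d x i) j ^+ d)
    & \esum_(j in [set: int])
        (localized_law d x i j * Qconv Q (localized_law d x i) j)%:E = S%:E].
Proof.
have [M lamM] := lam_bound; have [S SE] := powsum.
have lawE j : localized_law d x i j = lam (j - i).
  by rewrite /localized_law /lam /y; case: ifP => _; rewrite ?expr1n.
have u_gt0 j : 0 < u j by exact: Qconv_gt0 hQ lam_gt0 lamM _.
have yE j : y j = u j / u 0.
  have [->|j0] := eqVneq j 0; first by rewrite /y eqxx divff// gt_eqF.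
  rewrite y_nonzero//; case: hx => _ _ <-//; rewrite /Tmap Tmap_nonzero.
  congr (_ / _); rewrite -Tmap_nonzero; have [_ Qs -> _] := hQ; congr (_ + sumZ _ _).
  by apply/funext => k; rewrite sub0r Qs.
have convE j : Qconv Q (localized_law d x i) j = u (j - i).
  rewrite /u /Qconv /sumZ; congr fine.
  rewrite (esum_shift _ (e:=fun k => k + i) (f:=fun k => k - i)); last 2 first.
  - by move=> k; rewrite addrK.
  - by move=> k; rewrite subrK.
  by apply: eq_esum => k _; rewrite lawE addrK; congr (Q _ * _)%:E; ring.
exists M, (u 0 ^- d), (u 0 * S); split.
- by move=> j; rewrite lawE.
- by move=> j; rewrite lawE.
- split=> [|j]; first by rewrite invr_gt0 exprn_gt0.
  by rewrite lawE convE /lam yE expr_div_n mulrC.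
rewrite EFinM -SE -esumZl ?ltW//; last first.
  by move=> j; rewrite lee_fin exprn_ge0// ltW.
rewrite [RHS](esum_shift _ (e:=fun k => k - i) (f:=fun k => k + i)); last 2 first.
- by move=> k; rewrite subrK.
- by move=> k; rewrite addrK.
apply: eq_esum => j _; rewrite lawE convE -EFinM /lam exprS; congr EFin.
rewrite (_ : u (j - i) = y (j - i) * u 0); first by ring.
by rewrite yE divfK// gt_eqF.
Qed.
End Localized.

Lemma increment_nabla d (T : cayleyTree d) w (p : seq T) (sigma : heights T) :
  path adj w p -> increment (w :: p) (nabla sigma) = sigma (last w p) - sigma w.
Proof.
rewrite /increment /=; elim: p w => [|v p IH] w /=; first by rewrite big_nil subrr.
move=> /andP[wv vp]; rewrite big_cons IH//= /nabla_val wv; ring.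
Qed.

Lemma tree_pathE d (T : cayleyTree d) n (p : seq T) : tree_path n p ->
  exists w q, [/\ p = w :: q, path adj w q, uniq (w :: q) & size q = n].
Proof.
case: p => [|w q] /and3P[] //= wq uq /eqP[qn].
by exists w, q.
Qed.

Section Localization.
Context {R : realType} {d : nat} {T : cayleyTree d}.

(** The increment along a path of length [n] is [k] with probability
    the sum over [j] of [a j * nstep K n j (j + k)], where [a] is the stationary
    law; the chain is ergodic and [a] dominates the terms. *)
Lemma gibbs_increment_localizes (o : T) (Q : int -> R) (i : int)
    (mu : probability (heights T) R) (k : int) :
  transfer_operator Q -> localized_gibbs o Q i mu ->
  let alpha (j : int) := mu [set sigma : heights T | sigma o = j] in
  (0 < \esum_(j in [set: int]) (alpha j * alpha (j + k)%R))%E /\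
  forall p : nat -> seq T, (forall n, (1 <= n)%N -> tree_path n (p n)) ->
    pushforward mu (@nabla d T) [set eta : gradients T | increment (p n) eta = k]
      @[n --> \oo] --> (\esum_(j in [set: int]) (alpha j * alpha (j + k)%R))%E.
Proof.
move=> hQ [eps [x [_ hx mumu]]] alpha.
have [M [c [S [lam0 lamM [c0 lamE] SE]]]] := localized_law_props hQ hx i.
set lam := localized_law d x i in lam0 lamM lamE SE mumu.
have KS := gibbs_kernel_stochastic hQ lam0 lamM; set K := gibbs_kernel Q lam in KS.
have piS := gibbs_kernel_stationary hQ lam0 lamM; rewrite -/K in piS.
have S0 : 0 < S.
  rewrite -lte_fin -SE; have [pi0 _] := piS.
  apply: (@lt_le_trans _ _ (lam 0 * Qconv Q lam 0)%:E); first by rewrite lte_fin.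
  apply: (esum_ge_term (a:=fun j => (lam j * Qconv Q lam j)%:E)) => j.
  by rewrite lee_fin ltW.
pose a j := S^-1 * (lam j * Qconv Q lam j).
have aS : stationary K a by apply: stationaryZ => //; rewrite invr_gt0.
have [a0 _] := aS.
have a1 : \esum_(j in [set: int]) (a j)%:E = 1%E.
  rewrite /a; under eq_esum do rewrite EFinM.
  rewrite esumZl ?invr_ge0 ?(ltW S0)//; last first.
    by have [pi0 _] := piS => j; rewrite lee_fin ltW.
  by rewrite SE -EFinM mulVf// gt_eqF.
have two := gibbs_two_point hQ lam0 lamM c0 lamE SE mumu.
have alphaE j : alpha j = (a j)%:E.
  have := two o [::] isT isT j j; rewrite /nstep/= eqxx mulr1 => <-.
  by congr (mu _); apply/seteqP; split=> s /= => [->|[]].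
have -> : \esum_(j in [set: int]) (alpha j * alpha (j + k)%R)%E =
    \esum_(j in [set: int]) (a j * a (j + k))%:E.
  by apply: eq_esum => j _; rewrite !alphaE.
split.
  apply: (@lt_le_trans _ _ (a 0 * a (0 + k))%:E); first by rewrite lte_fin mulr_gt0.
  apply: (esum_ge_term (a:=fun j => (a j * a (j + k))%:E)) => j.
  by rewrite lee_fin mulr_ge0 ?ltW.
move=> p hp.
have law n : (1 <= n)%N ->
    pushforward mu (@nabla d T) [set eta : gradients T | increment (p n) eta = k] =
    \esum_(j in [set: int]) (a j * nstep K n j (j + k))%:E.
  move=> /hp/tree_pathE[w [q [-> wq uq qn]]].
  rewrite /pushforward /preimage/=.
  have -> : [set sigma : heights T | increment (w :: q) (nabla sigma) = k] =
      [set sigma : heights T | sigma (last w q) - sigma w = k].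
    by apply/seteqP; split=> s /=; rewrite increment_nabla.
  have mh := @measurable_height d T.
  rewrite (measure_level mu _ (mh w)).
    apply: eq_esum => j _; rewrite -qn.
    transitivity (mu [set s : heights T | s w = j /\ s (last w q) = j + k]);
      last exact: two.
    congr (mu _); apply/seteqP; split=> s /= [].
      by move=> <- <-; split=> //; ring.
    by move=> -> ->; split=> //; ring.
  refine (measurable_levelD (X:=fun s : heights T => s (last w q))
    (Y:=fun s : heights T => - s w) (mh _) _ k) => j.
  rewrite (_ : mkset _ = [set s : heights T | s w = - j])//.
  by apply/seteqP; split=> s /=; [move=> <-|move=> ->]; rewrite opprK.
have lim : \esum_(j in [set: int]) (a j * nstep K n j (j + k))%:E @[n --> \oo] -->
    \esum_(j in [set: int]) (a j * a (j + k))%:E.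
  apply: (tannery (M:=1)) => [j||n j|j]; first exact: ltW.
  - by rewrite a1 ltry.
  - exact: (nstep_unit n (j + k) KS j).
  - exact: nstep_ergodic.
apply: cvg_trans lim; apply: near_eq_cvg; near=> n.
by rewrite law//; near: n; exact: nbhs_infty_ge.
Unshelve. all: by end_near.
Qed.
End Localization.

(** * The kernel of a periodic law *)

Section PeriodicKernel.
Context {R : realType}.
Variables (d q : nat) (Q lam : int -> R).
Hypothesis q2 : (2 <= q)%N.
Hypothesis hQ : transfer_operator Q.
Hypothesis hlam : periodic_boundary_law d q Q lam.

Let Q0 i : 0 < Q i. Proof. by case: hQ. Qed.
Let Qsym i : Q (- i) = Q i. Proof. by case: hQ. Qed.
Let lam0 i : 0 < lam i. Proof. by case: hlam. Qed.

Lemma lam_modE (i : int) : lam_mod lam (i%:~R : 'Z_q) = lam i.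
Proof.
have [_ per _] := hlam.
have perM (n : nat) j : lam (j + (n * q)%:Z) = lam j.
  elim: n j => [|n IH] j; first by rewrite mul0n addr0.
  by rewrite mulSn addnC PoszD addrA per.
have perZ (m : int) j : lam (j + m * q%:Z) = lam j.
  case: m => n; first by rewrite -PoszM.
  by rewrite NegzE mulNr -PoszM -(perM n.+1 (j - _)) subrK.
have qz : (q%:Z)%:~R = 0 :> 'Z_q by rewrite -pmulrn -[RHS](pchar_Zp q2).
rewrite {2}(divz_eq i q%:Z) addrC perZ {1}(divz_eq i q%:Z).
rewrite rmorphD rmorphM/= qz mulr0 add0r /lam_mod.
have : (0 <= i %% q%:Z)%Z by rewrite modz_ge0// -lt0n (ltn_trans _ q2).
have : (i %% q%:Z < q%:Z)%Z by rewrite ltz_pmod// ltz_nat (ltn_trans _ q2).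
case: (i %% q%:Z)%Z => // r rq _.
by rewrite -pmulrn val_Zp_nat// modn_small.
Qed.

(** A positive function on the finite set ['Z_q] is bounded by the sum of its
    values, and from below by the inverse of the sum of their inverses. *)
Lemma lam_bounds : exists M m, [/\ 0 < m, forall i, lam i <= M & forall i, m <= lam i].
Proof.
have l0 (s : 'Z_q) : 0 < lam_mod lam s by exact: lam0.
have s0 : 0 < \sum_(s : 'Z_q) (lam_mod lam s)^-1.
  by rewrite (bigD1 0)//= ltr_pwDl ?invr_gt0// sumr_ge0// => s _; rewrite invr_ge0 ltW.
exists (\sum_(s : 'Z_q) lam_mod lam s), (\sum_(s : 'Z_q) (lam_mod lam s)^-1)^-1.
split=> [|i|i]; first by rewrite invr_gt0.
  rewrite -lam_modE (bigD1 (i%:~R : 'Z_q))//= lerDl sumr_ge0// => s _; exact: ltW.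
rewrite -[leRHS]invrK lef_pV2 ?posrE ?invr_gt0// -lam_modE.
by rewrite (bigD1 (i%:~R : 'Z_q))//= lerDl sumr_ge0// => s _; rewrite invr_ge0 ltW.
Qed.

Lemma Qmod_indicator (s : 'Z_q) : (Qmod Q s)%:E =
  \esum_(l in [set: int]) (Q l * (l%:~R == s)%:R)%:E.
Proof.
have [_ _ _ sQ] := hQ.
have ind : \esum_(l in [set l : int | l%:~R = s]) (Q l)%:E =
    \esum_(l in [set: int]) (Q l * (l%:~R == s)%:R)%:E.
  rewrite [LHS]esum_mkcond; apply: eq_esum => l _.
  have [ls|/eqP ls] := eqVneq (l%:~R : 'Z_q) s; first by rewrite mem_set// mulr1.
  by rewrite memNset// mulr0.
rewrite -ind sumZ_EFin//= => [l _|]; first exact: ltW.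
rewrite ind; apply: le_lt_trans sQ; apply: le_esum => l _ /=.
rewrite lee_fin ger0_norm ?(ltW (Q0 l))//.
by case: eqP => _; rewrite ?mulr1// mulr0 ltW.
Qed.

Lemma Qmod_gt0 (s : 'Z_q) : 0 < Qmod Q s.
Proof.
rewrite -lte_fin Qmod_indicator.
apply: (@lt_le_trans _ _ (Q (val s)%:Z * ((val s)%:Z%:~R == s)%:R)%:E).
  by rewrite -pmulrn natr_Zp eqxx mulr1 lte_fin.
apply: (esum_ge_term (a:=fun l => (Q l * (l%:~R == s)%:R)%:E)) => l.
by rewrite lee_fin mulr_ge0// ltW.
Qed.

Lemma QmodN (s : 'Z_q) : Qmod Q (- s) = Qmod Q s.
Proof.
apply: EFin_inj; rewrite !Qmod_indicator.
rewrite (esum_shift _ (e:=-%R) (f:=-%R)); [|exact: opprK|exact: opprK].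
by apply: eq_esum => l _; rewrite Qsym rmorphN/= eqr_opp.
Qed.

Lemma Qmod_conv (a : int) :
  \sum_(s : 'Z_q) Qmod Q (a%:~R - s) * lam_mod lam s = Qconv Q lam a.
Proof.
have [M [_ [_ lamM _]]] := lam_bounds.
apply: EFin_inj; rewrite -(QconvE hQ lam0 lamM) -sumEFin.
have l0 (s : 'Z_q) : 0 <= lam_mod lam s by exact: (ltW (lam0 _)).
transitivity (\sum_(s : 'Z_q) \esum_(l in [set: int])
    (lam_mod lam s * (Q l * (l%:~R == a%:~R - s :> 'Z_q)%:R))%:E)%E.
  apply: eq_bigr => s _; rewrite mulrC EFinM Qmod_indicator -esumZl//.
  by move=> l; rewrite lee_fin mulr_ge0// ltW.
rewrite -esum_sum; last by move=> l s _ _; rewrite lee_fin !mulr_ge0// ltW.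
rewrite (esum_shift _ (e:=fun j => a - j) (f:=fun j => a - j)); last 2 first.
- by move=> j; rewrite opprB addrC subrK.
- by move=> j; rewrite opprB addrC subrK.
apply: eq_esum => j _; rewrite sumEFin; congr EFin.
rewrite (bigD1 (j%:~R : 'Z_q))//= rmorphB/= eqxx lam_modE big1 ?addr0.
  by rewrite mulr1 mulrC.
move=> s sj; rewrite (inj_eq (addrI _)) eqr_opp eq_sym (negbTE sj).
by rewrite !mulr0.
Qed.

(** The class of a height modulo [q] moves according to [Pmod], and the increment
    is drawn in its class according to [rho]: together they are one step of the
    unreduced kernel. *)
Lemma Pmod_rho (a b : int) :
  Pmod Q lam (a%:~R : 'Z_q) b%:~R * rho Q (b - a) (b%:~R - a%:~R : 'Z_q) =
  gibbs_kernel Q lam a b.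
Proof.
rewrite /Pmod /rho Qmod_conv rmorphB eqxx lam_modE /gibbs_kernel.
rewrite -(opprB b%:~R) QmodN -(opprB b a) Qsym.
have [M [_ [_ lamM _]]] := lam_bounds.
have /lt0r_neq0 u0 := Qconv_gt0 hQ lam0 lamM a.
have /lt0r_neq0 Qm := Qmod_gt0 (b%:~R - a%:~R).
by field; rewrite u0 Qm.
Qed.

Lemma gibbs_kernel_shift (a i j : int) :
  gibbs_kernel Q (fun k => lam (a + k)) i j = gibbs_kernel Q lam (a + i) (a + j).
Proof.
rewrite /gibbs_kernel; congr (Q _ * _ / _); first by ring.
rewrite /Qconv /sumZ; congr fine.
rewrite [RHS](esum_shift _ (e:=fun k => a + k) (f:=fun k => k - a)); last 2 first.
- by move=> k; rewrite addrC addKr.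
- by move=> k; rewrite addrC subrK.
by apply: eq_esum => k _; congr (Q _ * _)%:E; ring.
Qed.
End PeriodicKernel.

(** * Increments under the gradient measure of a periodic law *)

Section Delocalization.
Context {R : realType} {d : nat} {T : cayleyTree d}.

Definition partial_increment (w : T) (p : seq T) (i : nat) (eta : gradients T) : int :=
  \sum_(j <- iota 0 i) eta (nth w (w :: p) j) (nth w p j).

Lemma incrementE w (p : seq T) (eta : gradients T) :
  increment (w :: p) eta = partial_increment w p (size p) eta.
Proof.
rewrite /increment /partial_increment.
have -> : zip (w :: p) p = [seq (nth w (w :: p) j, nth w p j) | j <- iota 0 (size p)].
  have sz : size (zip (w :: p) p) = size p.
    by rewrite size_zip; apply/minn_idPr; exact: leqnSn.
  apply: (@eq_from_nth _ (w, w)) => [|i]; first by rewrite sz size_map size_iota.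
  by rewrite nth_zip_cond sz => ip; rewrite ip (nth_map 0%N) ?size_iota// nth_iota.
by rewrite big_map.
Qed.

Lemma measurable_edge (x y : T) (k : int) :
  measurable [set eta : gradients T | eta x y = k].
Proof. by apply: sub_sigma_algebra; exists x, y, k. Qed.

Lemma measurable_increment (p : seq T) (k : int) :
  measurable [set eta : gradients T | increment p eta = k].
Proof.
exact: (measurable_level_sum (X:=fun b (eta : gradients T) => eta b.1 b.2)
  _ (fun b j => measurable_edge b.1 b.2 j)).
Qed.

(** In a tree the only edges between vertices of a path are those of the path, so
    the gradients on its vertex set are fixed by the partial increments. *)
Lemma gradient_path_event (w : T) (p : seq T) (t : T -> int) :
  path adj w p -> uniq (w :: p) -> t w = 0 ->
  [set eta : gradients T | forall x y : T, x \in [fset v in w :: p]%fset ->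
     y \in [fset v in w :: p]%fset -> eta x y = nabla (t : heights T) x y] =
  [set eta : gradients T | forall i, (i <= size p)%N ->
     partial_increment w p i eta = t (nth w (w :: p) i)].
Proof.
move=> wp up tw; have adjp i : (i < size p)%N -> adj (nth w (w :: p) i) (nth w p i).
  by move/pathP: wp; exact.
apply/seteqP; split=> eta /= H.
  elim=> [_|i IH ip]; first by rewrite /partial_increment big_nil tw.
  rewrite /partial_increment -addn1 iotaD big_cat/= big_seq1 add0n.
  rewrite -/(partial_increment w p i eta).
  rewrite IH ?(ltnW ip)// H ?in_fset.
  - rewrite /= /nabla_val adjp// addrC subrK addn1//.
  - by rewrite mem_nth//= ltnW.
  - by rewrite inE mem_nth// orbT.
have step x y : x \in [fset v in w :: p]%fset -> y \in [fset v in w :: p]%fset ->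
    away w x y -> eta x y = t y - t x.
  rewrite !in_fset => _; rewrite inE => /orP[/eqP ->|yp]; first by rewrite away_root.
  rewrite awayE => /andP[_ /eqP ->].
  have ip : (index y p < size p)%N by rewrite index_mem.
  have [_] := parent_path wp up ip; rewrite nth_index// => ->.
  have := H (index y p).+1 ip; rewrite /partial_increment -addn1 iotaD big_cat/=.
  rewrite big_seq1 -/(partial_increment w p _ eta) H ?(ltnW ip)// add0n addn1/=.
  by rewrite nth_index// => <-; ring.
move=> x y xL yL; rewrite /nabla_val; case: ifPn => [xy|nxy]; last exact: grad_off.
case/orP: (away_total w xy) => [/step->//|yx].
by rewrite grad_anti (step y x)// opprB.
Qed.

Variables (q : nat) (Q lam : int -> R).
Hypothesis q2 : (2 <= q)%N.
Hypothesis hQ : transfer_operator Q.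
Hypothesis hlam : periodic_boundary_law d q Q lam.

Let shifted (a : 'Z_q) (i : int) : R := lam ((a : nat)%:Z + i).

(** The increments determine the classes of all vertices from that of the root,
    so only one term of the sum over the hidden chain survives for each class of
    the root. *)
Lemma fuzzy_chain_path (w : T) (p : seq T) (t : T -> int)
    (wL : w \in [fset v in w :: p]%fset) :
  path adj w p -> uniq (w :: p) -> t w = 0 ->
  \sum_(s : {ffun [fset v in w :: p]%fset -> 'Z_q})
    fuzzy_chain Q lam [` wL]%fset s *
    \prod_(b : [fset v in w :: p]%fset * [fset v in w :: p]%fset |
           away w (val b.1) (val b.2))
      rho Q (nabla (t : heights T) (val b.1) (val b.2)) (s b.2 - s b.1) =
  \sum_(a : 'Z_q) alpha_mod d lam a *
    \prod_(i < size p) gibbs_kernel Q (shifted a)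
      (t (nth w (w :: p) i)) (t (nth w p i)).
Proof.
move=> wp up tw; set L := [fset v in w :: p]%fset in wL *.
pose lift (a : 'Z_q) : {ffun L -> 'Z_q} := [ffun v => a + (t (val v))%:~R].
have lift0 a : lift a [` wL]%fset = a by rewrite ffunE tw addr0.
rewrite (bigID (fun s : {ffun L -> 'Z_q} => lift (s [` wL]%fset) == s))/=.
rewrite [X in _ + X]big1 ?addr0; last first.
  (* a nonzero term forces the class of each next vertex along the path *)
  move=> s /eqP sP; apply/eqP; rewrite mulf_eq0; apply/orP; right.
  apply: contra_notT sP => /prodf_neq0 nz.
  apply/ffunP => -[v vL]; rewrite ffunE/=.
  have vp : v \in w :: p by move: (vL); rewrite in_fset.
  have all i (ip : (i < size (w :: p))%N) (iL : nth w (w :: p) i \in L) :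
      s [` iL]%fset = s [` wL]%fset + (t (nth w (w :: p) i))%:~R.
    elim: i ip iL => [_ iL|i IH ip iL].
      by rewrite /= tw addr0; congr (s _); exact: val_inj.
    have ip' : (i < size (w :: p))%N by exact: ltnW.
    have iL' : nth w (w :: p) i \in L by rewrite in_fset mem_nth.
    have [nw par] := parent_path wp up ip.
    have aw : away w (nth w (w :: p) i) (nth w p i) by rewrite awayE nw par eqxx.
    have := nz ([` iL']%fset, [` iL]%fset) aw; rewrite /rho /=.
    case: ifP => [/eqP + _|_]; last by rewrite eqxx.
    rewrite /nabla_val (away_adj aw) rmorphB/= (IH ip' iL') => H.
    apply: (addIr (- (s [` wL]%fset + (t (nth w (w :: p) i))%:~R))).
    by rewrite -H; ring.
  have ip : (index v (w :: p) < size (w :: p))%N by rewrite index_mem.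
  by have := all _ ip; rewrite nth_index// => /(_ vL) ->.
rewrite (reindex_onto lift (fun s : {ffun L -> 'Z_q} => s [` wL]%fset))/=;
  last by move=> s /eqP.
apply: eq_big => [a|a _]; first by rewrite lift0 !eqxx.
rewrite /fuzzy_chain lift0 -mulrA; congr (_ * _); rewrite -big_split/=.
pose G x y := Pmod Q lam (a + (t x)%:~R) (a + (t y)%:~R) *
  rho Q (nabla_val t x y) (a + (t y)%:~R - (a + (t x)%:~R)).
transitivity (\prod_(b : L * L | away w (val b.1) (val b.2)) G (val b.1) (val b.2)).
  by apply: eq_bigr => b _; rewrite !ffunE.
rewrite (prod_fset_pairs L (away w) G) (prod_away G) ?fset_uniq//; last first.
  by move=> y yL yw; apply: connected_parent => //; exact: connected_path.
rewrite -(prod_path (fun x y => gibbs_kernel Q (shifted a) (t x) (t y)) wp up).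
apply: eq_bigr => y yw.
rewrite /G /nabla_val parent_adj// (gibbs_kernel_shift Q lam) -(Pmod_rho q2 hQ hlam).
have aE : a = (a : nat)%:Z%:~R by rewrite -pmulrn natr_Zp.
by rewrite !rmorphD/= -aE; congr (_ * rho Q _ _); ring.
Qed.

(** The increment along a path of length [n] has the law of the position of a
    finite mixture of chains after [n] steps. Their common stationary measure is
    bounded below by periodicity, hence infinite, and the chains are null. *)
Lemma gradient_delocalizes (nu : probability (gradients T) R) (k : int)
    (p : nat -> seq T) :
  gradient_gibbs q Q lam nu -> (forall n, (1 <= n)%N -> tree_path n (p n)) ->
  nu [set eta : gradients T | increment (p n) eta = k] @[n --> \oo] --> 0%E.
Proof.
move=> hnu hp; have [lam0 _ _] := hlam.
have [M [m [m0 lamM lam_m]]] := lam_bounds q2 hlam.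
have s0 a i : 0 < shifted a i by exact: lam0.
have sM a i : shifted a i <= M by exact: lamM.
have KS a := gibbs_kernel_stochastic hQ (s0 a) (sM a).
have law n : (1 <= n)%N ->
    nu [set eta : gradients T | increment (p n) eta = k] =
    (\sum_(a : 'Z_q) alpha_mod d lam a *
       nstep (gibbs_kernel Q (shifted a)) n 0 k)%:E.
  move=> /hp/tree_pathE[w [r [-> wr ur <-]]].
  have wL : w \in [fset v in w :: r]%fset by rewrite in_fset mem_head.
  have a0 (a : 'Z_q) : 0 <= alpha_mod d lam a.
    by rewrite divr_ge0 ?powR_ge0// sumr_ge0// => *; rewrite powR_ge0.
  transitivity (nu [set eta : gradients T | partial_increment w r 0 eta = 0 /\
      partial_increment w r (size r) eta = k]).
    congr (nu _); apply/seteqP; split=> eta /=; rewrite incrementE.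
      by move=> ->; split=> //; rewrite /partial_increment big_nil.
    by case.
  rewrite (path_elimination (X:=partial_increment w r)
    (w:=fun (a : 'Z_q) z => alpha_mod d lam a * (z == 0)%:R)
    (K:=fun a => gibbs_kernel Q (shifted a)) (n:=size r))//.
  - by congr EFin; apply: eq_bigr => a _; rewrite eqxx mulr1.
  - move=> i j; exact: (measurable_level_sum
      (X:=fun l (eta : gradients T) => eta (nth w (w :: r) l) (nth w r l))
      _ (fun l k => measurable_edge _ _ k)).
  - by move=> a z; rewrite mulr_ge0.
  move=> h; have [h0|h0] := eqVneq (h 0%N) 0; last first.
    rewrite (_ : mkset _ = set0) ?measure0.
      by rewrite big1// => a _; rewrite mulr0 mul0r.
    apply/seteqP; split=> // eta /= /(_ 0%N isT); rewrite /partial_increment big_nil.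
    by move=> h00; rewrite -h00 eqxx in h0.
  pose t v := h (index v (w :: r)).
  have tn i : (i <= size r)%N -> t (nth w (w :: r) i) = h i.
    by move=> ip; rewrite /t index_uniq.
  have tw : t w = 0 by rewrite -h0 -(tn 0%N).
  transitivity (nu [set eta : gradients T | forall i, (i <= size r)%N ->
     partial_increment w r i eta = t (nth w (w :: r) i)]).
    by congr (nu _); apply/seteqP; split=> eta /= H i ir; rewrite H// tn.
  rewrite -gradient_path_event//.
  have := hnu _ [` wL]%fset (nabla (t : heights T)) (connected_path wr).
  move=> ->; rewrite (fuzzy_chain_path wL)//; congr EFin; apply: eq_bigr => a _.
  rewrite mulr1; congr (_ * _); apply: eq_bigr => i _.
  by rewrite (tn i) ?(ltnW (ltn_ord i))// (tn i.+1).
apply: (@cvg_trans _ ((\sum_(a : 'Z_q) alpha_mod d lam a *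
    nstep (gibbs_kernel Q (shifted a)) n 0 k)%:E @[n --> \oo])).
  apply: near_eq_cvg; near=> n; rewrite law//; near: n; exact: nbhs_infty_ge.
apply: (@cvg_comp _ _ _ _ EFin _ (nbhs (0 : R))) => //.
apply: cvg_sum0 => a; rewrite -(mulr0 (alpha_mod d lam a)); apply: cvgMr.
apply: (nstep_null _ _ (KS a) (gibbs_kernel_stationary hQ (s0 a) (sM a)) (m:=m ^+ 2)).
  by rewrite exprn_gt0.
move=> i; rewrite expr2; apply: ler_pM; rewrite ?(ltW m0) ?lam_m//.
exact: le_trans (lam_m _) (Qconv_ge hQ (s0 a) (sM a) i).
Unshelve. all: by end_near.
Qed.
End Delocalization.

(** * Delocalization against localization *)

Theorem theorem4 (R : realType) (d : nat) (T : cayleyTree d) (o : T)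
    (Q : int -> R) (hd : (2 <= d)%N) (hQ : transfer_operator Q) :
  [/\ (forall (q : nat) (lam : int -> R) (nu : probability (gradients T) R),
         (2 <= q)%N ->
         periodic_boundary_law d q Q lam ->
         gradient_gibbs q Q lam nu ->
         forall (k : int) (p : nat -> seq T),
           (forall n, (1 <= n)%N -> tree_path n (p n)) ->
           nu [set eta : gradients T | increment (p n) eta = k]
             @[n --> \oo] --> 0%E),
      (forall (i : int) (mu : probability (heights T) R),
         good_set d (Qgamma d Q, Qdelta d Q) ->
         localized_gibbs o Q i mu ->
         let nu := pushforward mu (@nabla d T) in
         let alpha (j : int) := mu [set sigma : heights T | sigma o = j] in
         forall k : int,
           (0 < \esum_(j in [set: int]) (alpha j * alpha (j + k)%R))%E /\
           forall p : nat -> seq T,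
             (forall n, (1 <= n)%N -> tree_path n (p n)) ->
             nu [set eta : gradients T | increment (p n) eta = k]
               @[n --> \oo]
               --> (\esum_(j in [set: int]) (alpha j * alpha (j + k)%R))%E)
    & (forall (q : nat) (lam : int -> R) (nu : probability (gradients T) R)
              (i : int) (mu : probability (heights T) R),
         (2 <= q)%N ->
         periodic_boundary_law d q Q lam ->
         gradient_gibbs q Q lam nu ->
         good_set d (Qgamma d Q, Qdelta d Q) ->
         localized_gibbs o Q i mu ->
         exists2 A : set (gradients T), measurable A &
           nu A <> pushforward mu (@nabla d T) A)].
Proof.
have locT i mu k := @gibbs_increment_localizes R d T o Q i mu k hQ.
split.
- move=> q lam nu q2 hlam hnu k p hp.
  exact: (gradient_delocalizes q2 hQ hlam _ hnu hp).
- by move=> i mu _ hmu nu alpha k; apply: locT hmu.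
move=> q lam nu i mu q2 hlam hnu _ hmu.
(* the increments along longer and longer paths would have two different limits *)
apply: contrapT => H.
have same A : measurable A -> nu A = pushforward mu (@nabla d T) A.
  by move=> mA; apply: contrapT => nA; apply: H; exists A.
have [p hp] := boolp.choice (fun n => tree_path_exists o n (ltnW hd)).
have [pos /(_ p (fun n _ => hp n)) lim] := locT i mu 0 hmu.
have lim0 := gradient_delocalizes q2 hQ hlam 0 hnu (fun n _ => hp n).
have E : (fun n => pushforward mu (@nabla d T)
      [set eta : gradients T | increment (p n) eta = 0]) =
    (fun n => nu [set eta : gradients T | increment (p n) eta = 0]).
  by apply/funext => n; rewrite same//; exact: measurable_increment.
rewrite E in lim; have := cvg_unique (@ereal_hausdorff R) lim lim0.
by move=> l0; rewrite l0 ltxx in pos.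
Qed.
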